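(* Let $\tau$ be the topology on $\mathbb{V}$ generated by the sets $T+\mathcal{U}_\varepsilon$ with $T\in\mathbb{V}$ and $\varepsilon>0$. Then: (A) $\Gamma_+$ is dense in $\Gamma$ with respect to $\tau$; (B) $\Gamma$ is the $\tau$-closure of $\Gamma_+$; (C) $\Gamma_+$ is reproducing, namely $\mathbb{V}=\Gamma_+-\Gamma_+$ (every element of $\mathbb{V}$ is a difference of two elements of $\Gamma_+$).
   Context: Scalars are $\mathbb{R}$ or $\mathbb{C}$; $\ell_p=\ell_p(\mathbb{N})$ with standard basis $(\delta_k)$; for $x\in\ell_1\subset\ell_2$, $xx^*$ is the rank-one operator $v\mapsto\langle v,x\rangle x$. $\mathbb{V}$ is the real vector space of bounded self-adjoint operators $A:\ell_2\to\ell_2$ with $\|A\|_{1,1}:=\sum_{k,l=1}^\infty|\langle A\delta_k,\delta_l\rangle|<\infty$. $\Gamma:=\{A\in\mathbb{V}:\langle Ax,x\rangle\ge0\ \forall x\in\ell_2\}$. For $A\in\Gamma$, $\gamma_+(A):=\inf\{\sum_{k=1}^\infty\|x_k\|_1^2: (x_k)\subset\ell_1,\ A=\sum_{k=1}^\infty x_kx_k^*\text{ strongly}\}$ with $\inf\varnothing=\infty$, and $\Gamma_+:=\{A\in\Gamma:\gamma_+(A)<\infty\}$. For $\varepsilon>0$, $\mathcal{U}_\varepsilon:=\{A\in\Gamma_+:\gamma_+(A)<\varepsilon\}$. *)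

(* Defs.v *)
From HB Require Import structures.
From mathcomp Require Import all_boot all_order all_algebra.
From mathcomp Require Import all_classical all_reals all_analysis.
From mathcomp Require Import complex ring lra.
Set Implicit Arguments.
Unset Strict Implicit.
Unset Printing Implicit Defensive.
Import Order.TTheory GRing.Theory Num.Theory.
Import numFieldNormedType.Exports.
Local Open Scope classical_set_scope.
Local Open Scope ring_scope.

Variant scalar_kind := Reals | Complexes.

Definition scalar (R : realType) (s : scalar_kind) : numFieldType :=
  match s with Reals => R | Complexes => R[i] end.

Section scalars.
Context {R : realType} {s : scalar_kind}.

Definition conjs : scalar R s -> scalar R s :=
  match s with Reals => fun z => z | Complexes => fun z => conjc z end.

(* The modulus with values in R: the norm `|z| of z : R[i] lives in R[i]. *)
Definition modulus : scalar R s -> R :=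
  match s with
  | Reals => fun z => `|z|
  | Complexes => fun z => ComplexField.Normc.normc z
  end.

Definition of_real : R -> scalar R s :=
  match s with Reals => fun r => r | Complexes => fun r => r%:C%C end.

End scalars.

Section scalar_theory.
Context {R : realType} {s : scalar_kind}.
Implicit Types (x y : scalar R s) (r : R).

Lemma norm_modulus x : `|x| = of_real (modulus x).
Proof. by case: s x => x //=; rewrite /of_real /modulus; case: x. Qed.

Lemma le_of_real r1 r2 :
  ((of_real r1 : scalar R s) <= of_real r2) = (r1 <= r2).
Proof. by case: s => //=; rewrite /of_real lecR. Qed.

Lemma of_realD r1 r2 : of_real (r1 + r2) = of_real r1 + of_real r2 :> scalar R s.
Proof. by case: s => //=; rewrite /of_real rmorphD. Qed.

Lemma of_realM r1 r2 : of_real (r1 * r2) = of_real r1 * of_real r2 :> scalar R s.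
Proof. by case: s => //=; rewrite /of_real rmorphM. Qed.

Lemma of_real1 : of_real 1 = 1 :> scalar R s.
Proof. by case: s. Qed.

Lemma of_real0 : of_real 0 = 0 :> scalar R s.
Proof. by case: s. Qed.

Lemma of_realN1 : of_real (-1) = -1 :> scalar R s.
Proof. by case: s => //; rewrite /of_real rmorphN1. Qed.

Lemma of_real_inj : injective (of_real : R -> scalar R s).
Proof. by case: s => [|] a b //= []. Qed.

Lemma modulus_ge0 x : 0 <= modulus x.
Proof. by rewrite -le_of_real -norm_modulus of_real0. Qed.

Lemma modulusD x y : modulus (x + y) <= modulus x + modulus y.
Proof. by rewrite -le_of_real of_realD -!norm_modulus ler_normD. Qed.

Lemma modulusM x y : modulus (x * y) = modulus x * modulus y.
Proof. by apply: of_real_inj; rewrite of_realM -!norm_modulus normrM. Qed.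

Lemma modulus0 : modulus (0 : scalar R s) = 0.
Proof. by apply: of_real_inj; rewrite -norm_modulus normr0 of_real0. Qed.

Lemma modulus1 : modulus (1 : scalar R s) = 1.
Proof. by apply: of_real_inj; rewrite -norm_modulus normr1 of_real1. Qed.

Lemma conjsD x y : conjs (x + y) = conjs x + conjs y.
Proof. by case: s x y => [|] x y //; rewrite /conjs rmorphD. Qed.

Lemma conjsM x y : conjs (x * y) = conjs x * conjs y.
Proof. by case: s x y => [|] x y //; rewrite /conjs rmorphM. Qed.

Lemma conjs_real r : conjs (of_real r : scalar R s) = of_real r.
Proof. by case: s => //; rewrite /conjs /of_real conjc_real. Qed.

Lemma modulus_conjs x : modulus (conjs x) = modulus x.
Proof.
by case: s x => [|] x //; case: x => a b; rewrite /modulus /conjs /= sqrrN.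
Qed.

End scalar_theory.

Lemma modulus_cvg (R : realType) (s : scalar_kind) (u : nat -> scalar R s) :
  cvgn (series (fun k => modulus (u k))) -> cvgn (series u).
Proof.
case: s u => [|] u cu.
  exact: (@normed_cvg R R^o u).
pose f (g : R[i] -> R) : nat -> R := fun k => g (u k).
have cf (g : R[i] -> R) :
    (forall z, `|g z| <= ComplexField.Normc.normc z) -> cvgn (series (f g)).
  move=> hg; apply: (@normed_cvg R R^o).
  apply: series_le_cvg cu => [k|k|k]; first exact: normr_ge0; last exact: hg.
  exact: modulus_ge0.
have cRe : cvgn (series (f (@complex.Re R))).
  apply: cf => -[a b] /=; rewrite -sqrtr_sqr ler_sqrt ?addr_ge0 ?sqr_ge0 //.
  by rewrite lerDl sqr_ge0.
have cIm : cvgn (series (f (@complex.Im R))).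
  apply: cf => -[a b] /=; rewrite -sqrtr_sqr ler_sqrt ?addr_ge0 ?sqr_ge0 //.
  by rewrite lerDr sqr_ge0.
have cC (v : nat -> R) :
    cvgn v -> cvgn (fun n => of_real (v n) : scalar R Complexes).
  move=> /cvg_ex[l vl]; apply/cvg_ex; exists (of_real l).
  apply/cvgrPdist_lt => -[e e'].
  rewrite ltcE /= => /andP[/eqP -> e0].
  move/cvgrPdist_lt : vl => /(_ _ e0); apply: filterS => n h.
  by rewrite /of_real -rmorphB normc_def /= expr0n /= addr0 sqrtr_sqr ltcR.
rewrite (_ : series u =
    (fun n => of_real (series (f (@complex.Re R)) n) : scalar R Complexes) +
    (fun n => ('i%C : scalar R Complexes) *
              of_real (series (f (@complex.Im R)) n))).
  apply: is_cvgD; first exact: cC.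
  by apply: is_cvgM; [exact: is_cvg_cst | exact: cC].
apply/funext => n; rewrite [RHS]/GRing.add /= /series /= !rmorph_sum mulr_sumr.
by rewrite -big_split; apply: eq_bigr => k _; exact: complexE.
Qed.

Definition l2_pred (R : realType) (s : scalar_kind) : {pred nat -> scalar R s} :=
  fun x => `[< cvgn (series (fun k => modulus (x k) ^+ 2)) >].

Lemma modulus_combination (R : realType) (s : scalar_kind) (a x y : scalar R s) :
  modulus (a * x + y) ^+ 2 <=
  2 * modulus a ^+ 2 * modulus x ^+ 2 + 2 * modulus y ^+ 2.
Proof.
apply: le_trans (_ : (modulus a * modulus x + modulus y) ^+ 2 <= _).
  rewrite ler_sqr ?nnegrE ?addr_ge0 ?mulr_ge0 ?modulus_ge0 //.
  by rewrite -modulusM modulusD.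
have := sqr_ge0 (modulus a * modulus x - modulus y).
by lra.
Qed.

Lemma l2_submod_closed (R : realType) (s : scalar_kind) :
  submod_closed (@l2_pred R s).
Proof.
split=> [|a x y /asboolP cx /asboolP cy]; apply/asboolP.
  rewrite (_ : series _ = cst 0); first exact: is_cvg_cst.
  by apply/funext => n; rewrite /series /= big1 // => k _; rewrite modulus0 expr0n.
apply: (@series_le_cvg _ _ ((2 * modulus a ^+ 2) *: (fun k => modulus (x k) ^+ 2) +
                            2 *: (fun k => modulus (y k) ^+ 2))).
- by move=> k; rewrite sqr_ge0.
- move=> k; apply: addr_ge0; rewrite /GRing.scale /=; last first.
    by rewrite mulr_ge0 ?sqr_ge0.
  by rewrite !mulr_ge0 ?modulus_ge0 ?sqr_ge0.
- by move=> k; exact: modulus_combination.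
- by apply: is_cvg_seriesD; apply: is_cvg_seriesZ.
Qed.

HB.instance Definition _ (R : realType) (s : scalar_kind) :=
  GRing.isSubmodClosed.Build (scalar R s) (nat -> scalar R s) (@l2_pred R s)
    (@l2_submod_closed R s).

Record l2 (R : realType) (s : scalar_kind) :=
  L2 { l2_seq :> nat -> scalar R s; l2_seqP : l2_seq \in @l2_pred R s }.

Section l2_instances.
Variables (R : realType) (s : scalar_kind).
HB.instance Definition _ := [isSub for @l2_seq R s].
HB.instance Definition _ := [Choice of l2 R s by <:].
HB.instance Definition _ := [SubChoice_isSubLmodule of l2 R s by <:].
End l2_instances.

Section l2_space.
Context {R : realType} {s : scalar_kind}.
Implicit Types (x y z v : l2 R s) (k : nat).

(* Linear in the first argument; the series converges (inner_cvg below), so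
   that lim is the actual sum. *)
Definition inner x y : scalar R s := limn (series (fun k => x k * conjs (y k))).

Definition norm2 x : R := Num.sqrt (limn (series (fun k => modulus (x k) ^+ 2))).

Definition in_l1 x : Prop := cvgn (series (fun k => modulus (x k))).

(* Only meaningful when in_l1 x holds. *)
Definition norm1 x : R := limn (series (fun k => modulus (x k))).

Lemma delta_subproof k :
  (fun j => (j == k)%:R : scalar R s) \in @l2_pred R s.
Proof.
apply/asboolP; apply: (is_cvg_near_cst (1 : R)).
exists k.+1 => // n /= kn; rewrite /series /= big_mkord.
rewrite (bigD1 (Ordinal kn)) //= eqxx modulus1 expr1n big1 ?addr0 // => j jk.
rewrite (_ : (_ == _) = false) ?modulus0 ?expr0n //.
by apply: contraNF jk => /eqP jk; apply/eqP/val_inj.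
Qed.

Definition delta k : l2 R s := L2 (delta_subproof k).

(* the rank-one operator x x^* *)
Definition rank1 x v : l2 R s := inner v x *: x.

Definition bounded_op (A : l2 R s -> l2 R s) : Prop :=
  exists M : R, forall x, norm2 (A x) <= M * norm2 x.

Definition self_adjoint (A : l2 R s -> l2 R s) : Prop :=
  forall x y, inner (A x) y = inner x (A y).

Definition norm11 (A : l2 R s -> l2 R s) : \bar R :=
  \esum_(kl in [set: nat * nat])
    (modulus (inner (A (delta kl.1)) (delta kl.2)))%:E.

Definition V_pred : {pred l2 R s -> l2 R s} := fun A =>
  `[< [/\ linear A, bounded_op A, self_adjoint A & (norm11 A < +oo)%E] >].

End l2_space.

Section V_closed.
Context {R : realType} {s : scalar_kind}.
Implicit Types (x y z v : l2 R s) (a : scalar R s) (A B : l2 R s -> l2 R s).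

Lemma l2_cvg x : cvgn (series (fun k => modulus (x k) ^+ 2)).
Proof. by case: x => x /= /asboolP. Qed.

Lemma inner_cvg x y : cvgn (series (fun k => x k * conjs (y k))).
Proof.
apply: modulus_cvg; apply: (@series_le_cvg _ _
  ((fun k => modulus (x k) ^+ 2) + (fun k => modulus (y k) ^+ 2))).
- by move=> k; exact: modulus_ge0.
- by move=> k; apply: addr_ge0; exact: sqr_ge0.
- move=> k; rewrite modulusM modulus_conjs [leRHS]/GRing.add /=.
  have := sqr_ge0 (modulus (x k) - modulus (y k)).
  have := mulr_ge0 (modulus_ge0 (x k)) (modulus_ge0 (y k)).
  by nra.
- by apply: is_cvg_seriesD; exact: l2_cvg.
Qed.

Lemma l2_combinationE a x y k : (a *: x + y) k = a * x k + y k.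
Proof. by []. Qed.

Lemma limM_series (K : numFieldType) (c : K) (u : nat -> K) :
  cvgn (series u) -> c * limn (series u) = limn (series (c *: u)).
Proof. by move=> cu; rewrite lim_seriesZ. Qed.

Lemma inner_combinationl a x y z :
  inner (a *: x + y) z = a * inner x z + inner y z.
Proof.
rewrite /inner limM_series; last exact: inner_cvg.
rewrite -lim_seriesD; [|apply: is_cvg_seriesZ; exact: inner_cvg|exact: inner_cvg].
congr (limn (series _)); apply/funext => k.
by rewrite l2_combinationE mulrDl -mulrA.
Qed.

Lemma inner_combinationr a x y z :
  inner z (a *: x + y) = conjs a * inner z x + inner z y.
Proof.
rewrite /inner limM_series; last exact: inner_cvg.
rewrite -lim_seriesD; [|apply: is_cvg_seriesZ; exact: inner_cvg|exact: inner_cvg].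
congr (limn (series _)); apply/funext => k.
by rewrite l2_combinationE conjsD conjsM mulrDr mulrCA.
Qed.

Lemma inner0l x : inner 0 x = 0.
Proof.
by have := inner_combinationl (-1) 0 0 x; rewrite scaler0 addr0 mulN1r addNr.
Qed.

Lemma inner0r x : inner x 0 = 0.
Proof.
rewrite /inner (_ : series _ = cst 0) ?lim_cst //.
apply/funext => n; rewrite /series /= big1 // => k _.
by rewrite -[LHS]/(x k * conjs 0) -of_real0 conjs_real of_real0 mulr0.
Qed.

Lemma norm2_sqr x : norm2 x ^+ 2 = limn (series (fun k => modulus (x k) ^+ 2)).
Proof.
rewrite sqr_sqrtr //; apply: limr_ge; first exact: l2_cvg.
by apply: nearW => n; apply: sumr_ge0 => k _; exact: sqr_ge0.
Qed.

Lemma norm2_ge0 x : 0 <= norm2 x. Proof. exact: sqrtr_ge0. Qed.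

Lemma norm2_combination a x y :
  norm2 (a *: x + y) ^+ 2 <=
  2 * modulus a ^+ 2 * norm2 x ^+ 2 + 2 * norm2 y ^+ 2.
Proof.
rewrite !norm2_sqr.
have h : cvgn (series ((2 * modulus a ^+ 2) *: (fun k => modulus (x k) ^+ 2) +
                       2 *: (fun k => modulus (y k) ^+ 2))).
  by apply: is_cvg_seriesD; apply: is_cvg_seriesZ; exact: l2_cvg.
rewrite !limM_series; try exact: l2_cvg.
rewrite -lim_seriesD; try by apply: is_cvg_seriesZ; exact: l2_cvg.
apply: ler_lim; [exact: l2_cvg | exact: h |].
by apply: nearW => n; apply: ler_sum => k _; exact: modulus_combination.
Qed.

Lemma esumZ_le (T : choiceType) (I : set T) (c : R) (f : T -> \bar R) :
  0 <= c -> (forall i, 0 <= f i)%E ->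
  (\esum_(i in I) (c%:E * f i) <= c%:E * \esum_(i in I) f i)%E.
Proof.
move=> c0 f0; apply: ge_ereal_sup => /= _ [X XI <-].
rewrite -ge0_mule_fsumr //; apply: lee_wpmul2l; first by rewrite lee_fin.
by apply: esum_ge; exists X.
Qed.

Lemma V_combination (r : R) A B : A \in V_pred -> B \in V_pred ->
  (of_real r : scalar R s) *: A + B \in V_pred.
Proof.
move=> /asboolP[lA [M bA] sA nA] /asboolP[lB [N bB] sB nB].
apply/asboolP; split.
- move=> a x y.
  rewrite -[LHS]/(of_real r *: A (a *: x + y) + B (a *: x + y)).
  rewrite -[RHS]/(a *: (of_real r *: A x + B x) + (of_real r *: A y + B y)).
  by rewrite lA lB !scalerDr !scalerA [of_real r * a]mulrC addrACA.
- set c := modulus (of_real r : scalar R s).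
  pose K := 2 * c ^+ 2 * M ^+ 2 + 2 * N ^+ 2.
  have K0 : 0 <= K.
    apply: addr_ge0; apply: mulr_ge0; rewrite ?sqr_ge0 //.
    by apply: mulr_ge0; rewrite ?sqr_ge0.
  exists (Num.sqrt K) => x.
  rewrite -ler_sqr ?nnegrE ?mulr_ge0 ?sqrtr_ge0 ?norm2_ge0 //.
  apply: le_trans (norm2_combination _ _ _) _.
  rewrite -/c [leRHS]exprMn (sqr_sqrtr K0) /K.
  have sq (C : R) (D : l2 R s -> l2 R s) :
      norm2 (D x) <= C * norm2 x -> norm2 (D x) ^+ 2 <= C ^+ 2 * norm2 x ^+ 2.
    move=> h; rewrite -exprMn ler_sqr ?nnegrE ?norm2_ge0 //.
    exact: le_trans (norm2_ge0 _) h.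
  have hA := ler_wpM2l (sqr_ge0 c) (sq _ _ (bA x)).
  have hB := sq _ _ (bB x).
  by lra.
- move=> x y; rewrite inner_combinationl inner_combinationr conjs_real.
  by rewrite sA sB.
- have m0 A' (kl : nat * nat) :
      (0 <= (modulus (inner (A' (@delta R s kl.1)) (delta kl.2)))%:E)%E.
    by rewrite lee_fin modulus_ge0.
  apply: (@le_lt_trans _ _
    (\esum_(kl in [set: nat * nat])
       ((modulus (of_real r : scalar R s))%:E *
         (modulus (inner (A (delta kl.1)) (delta kl.2)))%:E +
        (modulus (inner (B (delta kl.1)) (delta kl.2)))%:E))%E).
    apply: le_esum => kl _; rewrite -EFinM -EFinD lee_fin inner_combinationl.
    by rewrite -modulusM modulusD.
  rewrite esumD => [|kl _|kl _]; [|by rewrite mule_ge0 ?lee_fin ?modulus_ge0|exact: m0].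
  rewrite lte_add_pinfty //; apply: le_lt_trans (esumZ_le _ _ _) _ => //.
    exact: modulus_ge0.
  by rewrite lte_mul_pinfty // lee_fin modulus_ge0.
Qed.

Lemma V_pred0 : (0 : l2 R s -> l2 R s) \in V_pred.
Proof.
apply/asboolP; split.
- by move=> a x y; rewrite scaler0 addr0.
- exists 0 => x; rewrite mul0r /norm2 (_ : series _ = cst 0) ?lim_cst ?sqrtr0 //.
  apply/funext => n; rewrite /series /= big1 // => k _.
  by rewrite -[X in modulus X]/(0 : scalar R s) modulus0 expr0n.
- by move=> x y; rewrite inner0l inner0r.
- by rewrite /norm11 esum1 // => kl _; rewrite inner0l modulus0.
Qed.

Lemma V_zmod_closed : zmod_closed (@V_pred R s).
Proof.
split=> [|A B VA VB]; first exact: V_pred0.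
by rewrite addrC -scaleN1r -of_realN1; exact: V_combination.
Qed.

HB.instance Definition _ :=
  GRing.isZmodClosed.Build (l2 R s -> l2 R s) (@V_pred R s) V_zmod_closed.

Lemma V_scale_closed (r : R) A :
  A \in V_pred -> (of_real r : scalar R s) *: A \in V_pred.
Proof.
by move=> VA; rewrite -[_ *: _]addr0; exact: V_combination VA V_pred0.
Qed.

End V_closed.

Record V (R : realType) (s : scalar_kind) :=
  MkV { V_op :> l2 R s -> l2 R s; V_opP : V_op \in @V_pred R s }.

Section V_instances.
Variables (R : realType) (s : scalar_kind).

HB.instance Definition _ := [isSub for @V_op R s].
HB.instance Definition _ := [Choice of V R s by <:].
HB.instance Definition _ := [SubChoice_isSubZmodule of V R s by <:].

Definition V_scale (r : R) (A : V R s) : V R s :=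
  MkV (V_scale_closed r (V_opP A)).

Program Definition V_lmodMixin :=
  @GRing.Zmodule_isLmodule.Build R (V R s) V_scale _ _ _ _.
Next Obligation.
by move=> a b A; apply: val_inj => /=; rewrite scalerA of_realM.
Qed.
Next Obligation. by move=> A; apply: val_inj => /=; rewrite of_real1 scale1r. Qed.
Next Obligation. by move=> a A B; apply: val_inj => /=; rewrite scalerDr. Qed.
Next Obligation.
by move=> A a b; apply: val_inj => /=; rewrite of_realD scalerDl.
Qed.
HB.instance Definition _ := V_lmodMixin.
HB.instance Definition _ := isPointed.Build (V R s) 0.

End V_instances.

Section Gamma.
Context {R : realType} {s : scalar_kind}.

(* In R[i], 0 <= z means that z is real and nonnegative. *)
Definition Gamma : set (V R s) := [set A | forall x : l2 R s, 0 <= inner (A x) x].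

(* A is the strong sum of the series of the rank-one operators x_k x_k^* *)
Definition strong_sum (x : nat -> l2 R s) (A : V R s) : Prop :=
  forall v : l2 R s,
    (fun n => norm2 (\sum_(k < n) rank1 (x k) v - A v)) @ \oo --> (0 : R).

Definition gamma_plus (A : V R s) : \bar R :=
  ereal_inf [set (\sum_(0 <= k <oo) ((norm1 (x k)) ^+ 2)%:E)%E | x in
    [set x : nat -> l2 R s | (forall k, in_l1 (x k)) /\ strong_sum x A]].

Definition Gamma_plus : set (V R s) :=
  [set A | Gamma A /\ (gamma_plus A < +oo)%E].

Definition U_ (e : R) : set (V R s) :=
  [set A | Gamma_plus A /\ (gamma_plus A < e%:E)%E].

End Gamma.

HB.instance Definition _ (R : realType) (s : scalar_kind) :=
  isSubBaseTopological.Build (V R s)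
    [set Te : V R s * R | 0 < Te.2]
    (fun Te => [set Te.1 + B | B in U_ Te.2]).

(* D is dense in S for the topology induced on S. *)
Definition dense_in (T : topologicalType) (S D : set T) : Prop :=
  D `<=` S /\
  forall O : set T, open O -> (O `&` S) !=set0 -> (O `&` D) !=set0.

(* Main.v *)
(* For D in V let r_k = D delta_k be the rows of D up to conjugation.  Polarisation
   with the weight norm1 r_k writes D as B - C, where B and C are series of
   rank-one operators whose cost is at most a constant times norm11 D; this is
   reproducibility.  For density, split A in Gamma into its n x n corner P, which
   is a finite sum of rank-one operators by Cholesky elimination, and a remainder
   D with norm11 D small: with D = B - C as above, A + C = P + B lies in Gamma_+
   and gamma_+(C) is small.  Since gamma_+ is subadditive, the sets A + U_eps form
   a basis of neighbourhoods of A, and 0 <= <Cx, x> <= gamma_+(C) |x|^2 shows that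
   Gamma is closed. *)
From mathcomp Require Import all_boot all_order all_algebra.
From mathcomp Require Import all_classical all_reals all_analysis.
From mathcomp Require Import complex ring lra.
Require Import Defs.
Set Implicit Arguments.
Unset Strict Implicit.
Unset Printing Implicit Defensive.
Import Order.TTheory GRing.Theory Num.Theory.
Import numFieldNormedType.Exports.
Local Open Scope classical_set_scope.
Local Open Scope ring_scope.

(** * Conjugation, modulus and limits, uniformly for real and complex scalars *)

Section scalars.
Context {R : realType} {s : scalar_kind}.
Implicit Types (x y z : scalar R s) (r : R).

Lemma conjsK x : conjs (conjs x) = x.
Proof. by case: s x => [|] x //; rewrite /conjs conjcK. Qed.

Lemma mul_conjs x : x * conjs x = of_real (modulus x ^+ 2).
Proof.
case: s x => [|] x; first by rewrite /conjs /modulus /of_real -expr2 real_normK ?num_real.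
case: x => a b; rewrite /conjs /modulus /of_real /= sqr_sqrtr ?addr_ge0 ?sqr_ge0 //.
by apply/eqP; rewrite eq_complex /=; apply/andP; split; apply/eqP; ring.
Qed.

Lemma ge0_of_real z : 0 <= z -> z = of_real (modulus z).
Proof. by move=> z0; rewrite -norm_modulus ger0_norm. Qed.

Lemma of_realB r1 r2 : of_real (r1 - r2) = of_real r1 - of_real r2 :> scalar R s.
Proof. by rewrite of_realD -[- r2]mulN1r of_realM of_realN1 mulN1r. Qed.

Lemma modulus_of_real r : modulus (of_real r : scalar R s) = `|r|.
Proof.
case: s => //; rewrite /modulus /of_real /=.
by rewrite expr0n /= addr0 sqrtr_sqr.
Qed.

Lemma ge0_modulus_of_real r : 0 <= r -> modulus (of_real r : scalar R s) = r.
Proof. by move=> r0; rewrite modulus_of_real ger0_norm. Qed.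

Lemma modulus_eq0 x : modulus x = 0 -> x = 0.
Proof.
by move=> x0; apply/eqP; rewrite -normr_eq0 norm_modulus x0 of_real0.
Qed.

Lemma modulusN x : modulus (- x) = modulus x.
Proof. by apply: (@of_real_inj R s); rewrite -!norm_modulus normrN. Qed.

Lemma modulus_sum (I : Type) (t : seq I) (P : pred I) (F : I -> scalar R s) :
  modulus (\sum_(i <- t | P i) F i) <= \sum_(i <- t | P i) modulus (F i).
Proof.
elim/big_ind2 : _ => [|x1 x2 y1 y2 h1 h2|//]; first by rewrite modulus0.
by apply: le_trans (modulusD _ _) _; exact: lerD.
Qed.

Lemma conjs0 : conjs (0 : scalar R s) = 0.
Proof. by rewrite -of_real0 conjs_real. Qed.

Lemma conjs1 : conjs (1 : scalar R s) = 1.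
Proof. by rewrite -of_real1 conjs_real. Qed.

Lemma conjsN x : conjs (- x) = - conjs x.
Proof. by rewrite -mulN1r conjsM -of_realN1 conjs_real of_realN1 mulN1r. Qed.

Lemma conjs_sum (I : Type) (t : seq I) (P : pred I) (F : I -> scalar R s) :
  conjs (\sum_(i <- t | P i) F i) = \sum_(i <- t | P i) conjs (F i).
Proof.
elim/big_ind2 : _ => [|x1 x2 y1 y2 h1 h2|//]; first by rewrite conjs0.
by rewrite conjsD h1 h2.
Qed.

(** The norm of a complex scalar is itself complex, so the epsilons on the left are scalars. A
    positive scalar is [of_real] of its modulus, which turns them into real epsilons and back. *)
Lemma cvg_modulusP (u : nat -> scalar R s) z :
  u @ \oo --> z <-> (fun n => modulus (u n - z)) @ \oo --> (0 : R).
Proof.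
split=> /cvgrPdist_lt h; apply/cvgrPdist_lt => e e0.
  have e0' : (0 : scalar R s) < of_real e.
    rewrite lt0r -of_real0 le_of_real (ltW e0) andbT.
    by apply/eqP => /of_real_inj ee; rewrite ee ltxx in e0.
  have := h _ e0'; apply: filterS => n.
  rewrite norm_modulus lt_neqAle le_of_real => /andP[ne le].
  rewrite sub0r normrN ger0_norm ?modulus_ge0 // lt_neqAle -opprB modulusN le andbT.
  by apply: contraNneq ne => ->.
have ee := ge0_of_real (ltW e0).
have e0' : 0 < modulus e.
  rewrite lt0r modulus_ge0 andbT; apply/eqP => /modulus_eq0 e00.
  by rewrite e00 ltxx in e0.
have := h _ e0'; apply: filterS => n.
rewrite sub0r normrN ger0_norm ?modulus_ge0 // norm_modulus => lt.
rewrite ee lt_neqAle le_of_real -opprB modulusN (ltW lt) andbT.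
by apply/eqP => /of_real_inj eq; rewrite eq ltxx in lt.
Qed.

Lemma cvg_modulus (u : nat -> scalar R s) z :
  u @ \oo --> z -> (fun n => modulus (u n)) @ \oo --> modulus z.
Proof.
move=> /cvg_modulusP h; apply/cvgrPdist_le => e e0.
move/cvgrPdist_le : h => /(_ _ e0); apply: filterS => n.
rewrite sub0r normrN ger0_norm ?modulus_ge0 //; apply: le_trans.
rewrite ler_norml; apply/andP; split.
  have := modulusD (u n - z) z; rewrite subrK; lra.
have := modulusD (z - u n) (u n); rewrite subrK -[z - u n]opprB modulusN; lra.
Qed.

Lemma cvg_conjs (u : nat -> scalar R s) z :
  u @ \oo --> z -> (fun n => conjs (u n)) @ \oo --> conjs z.
Proof.
move=> /cvg_modulusP h; apply/cvg_modulusP; apply: cvg_trans h.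
by apply: near_eq_cvg; near=> n; rewrite -conjsN -conjsD modulus_conjs.
Unshelve. all: by end_near. Qed.

End scalars.

(** Positivity of [f] at [t f(x,y) y + x] makes a quadratic polynomial in the real number [t]
    nonnegative. The form is abstract and possibly degenerate, so that the result covers both
    [inner] and the form [inner (A x) y] of an operator [A] in [Gamma]. *)
Lemma psd_form_cauchy_schwarz (R : realType) (s : scalar_kind)
    (T : lmodType (scalar R s)) (f : T -> T -> scalar R s) (x y : T) :
  (forall a x y z, f (a *: x + y) z = a * f x z + f y z) ->
  (forall x y, f y x = conjs (f x y)) ->
  (forall x, 0 <= f x x) ->
  modulus (f x y) ^+ 2 <= modulus (f x x) * modulus (f y y).
Proof.
move=> flin fherm fpos.
set a := modulus (f x x); set b := modulus (f y y); set m := modulus (f x y).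
have frlin c u v w : f w (c *: u + v) = conjs c * f w u + f w v.
  by rewrite fherm flin conjsD conjsM -!fherm.
have key (t : R) : 0 <= a + 2 * t * m ^+ 2 + t ^+ 2 * m ^+ 2 * b.
  have := fpos ((of_real t * f x y) *: y + x).
  rewrite flin !frlin conjsM conjs_real [f y x]fherm.
  rewrite [f x x]ge0_of_real // [f y y]ge0_of_real // -/a -/b.
  have -> : of_real t * f x y * (of_real t * conjs (f x y) * of_real b + conjs (f x y)) +
     (of_real t * conjs (f x y) * f x y + of_real a) =
     of_real (a + 2 * t * m ^+ 2 + t ^+ 2 * m ^+ 2 * b).
    have : of_real (m ^+ 2) = f x y * conjs (f x y) by rewrite mul_conjs.
    move: (m ^+ 2) => M ME; have -> : 2 * t = t + t by ring.
    rewrite expr2 !(of_realD, of_realM) ME; ring.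
  by rewrite -of_real0 le_of_real.
have a0 : 0 <= a by exact: modulus_ge0.
have [b0|b0] := eqVneq b 0.
  have [->|m0] := eqVneq m 0; first by rewrite b0 mulr0 expr0n.
  have m20 : m ^+ 2 != 0 by rewrite expf_eq0.
  (* For [b = 0] the polynomial is affine with slope [2 m^2]; this [t] gives it the value -1. *)
  have := key (- (a + 1) / (2 * m ^+ 2)).
  have -> : a + 2 * (- (a + 1) / (2 * m ^+ 2)) * m ^+ 2 +
     (- (a + 1) / (2 * m ^+ 2)) ^+ 2 * m ^+ 2 * b = -1.
    by rewrite b0; field.
  by rewrite ler0N1.
have bp : 0 < b by rewrite lt0r b0 modulus_ge0.
(* For [b > 0] this is the minimiser of the quadratic. *)
have := key (- b^-1).
have -> : a + 2 * - b^-1 * m ^+ 2 + (- b^-1) ^+ 2 * m ^+ 2 * b = a - m ^+ 2 / b.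
  by field.
by rewrite subr_ge0 ler_pdivrMr.
Qed.

(** * Hilbert space geometry of [l2] and comparison with the norm of ell_1 *)

Section l2_theory.
Context {R : realType} {s : scalar_kind}.
Implicit Types (x y z v : l2 R s) (a : scalar R s) (k l m n : nat).

Lemma l2_ext x y : (forall k, x k = y k) -> x = y.
Proof. by move=> xy; apply: val_inj; apply/funext. Qed.

Lemma cvg_of_real (u : nat -> R) (r : R) :
  u @ \oo --> r -> (fun n => of_real (u n) : scalar R s) @ \oo --> of_real r.
Proof.
move=> ur; apply/cvg_modulusP; apply/cvgrPdist_lt => e e0.
move/cvgrPdist_lt : ur => /(_ _ e0); apply: filterS => n.
by rewrite -of_realB modulus_of_real sub0r normrN normr_id distrC.
Qed.

Lemma of_real_sum (I : Type) (t : seq I) (P : pred I) (f : I -> R) :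
  of_real (\sum_(i <- t | P i) f i) = \sum_(i <- t | P i) of_real (f i) :> scalar R s.
Proof.
elim/big_ind2 : _ => [|x1 x2 y1 y2 <- <-|//]; first exact: of_real0.
by rewrite of_realD.
Qed.

Lemma l2_sumE (I : Type) (t : seq I) (P : pred I) (u : I -> l2 R s) m :
  (\sum_(i <- t | P i) u i) m = \sum_(i <- t | P i) u i m.
Proof. by elim/big_ind2 : _ => [//|x1 x2 y1 y2 <- <-|//]. Qed.

Lemma cvg_inner x y : (fun n => \sum_(k < n) x k * conjs (y k)) @ \oo --> inner x y.
Proof.
have := @inner_cvg R s x y; rewrite /inner; apply: cvg_trans.
by apply: near_eq_cvg; near=> n; rewrite /series /= big_mkord.
Unshelve. all: by end_near. Qed.

Lemma cvg_norm2 x : (fun n => \sum_(k < n) modulus (x k) ^+ 2) @ \oo --> norm2 x ^+ 2.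
Proof.
have := @l2_cvg R s x; rewrite norm2_sqr; apply: cvg_trans.
by apply: near_eq_cvg; near=> n; rewrite /series /= big_mkord.
Unshelve. all: by end_near. Qed.

Arguments cvg_inner : clear implicits.
Arguments cvg_norm2 : clear implicits.

Lemma inner_unique x y c :
  (fun n => \sum_(k < n) x k * conjs (y k)) @ \oo --> c -> inner x y = c.
Proof. by move=> h; apply: (@norm_cvg_unique _ _ _ _ _ _ (cvg_inner x y) h). Qed.

Lemma inner_sym x y : inner y x = conjs (inner x y).
Proof.
apply: inner_unique; apply: cvg_trans (cvg_conjs (cvg_inner x y)).
apply: near_eq_cvg; near=> n; rewrite conjs_sum; apply: eq_bigr => k _.
by rewrite conjsM conjsK mulrC.
Unshelve. all: by end_near. Qed.

Lemma inner_norm2 x : inner x x = of_real (norm2 x ^+ 2).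
Proof.
apply: inner_unique; apply: cvg_trans (cvg_of_real (cvg_norm2 x)).
apply: near_eq_cvg; near=> n.
by rewrite /= of_real_sum; apply: eq_bigr => k _; rewrite mul_conjs.
Unshelve. all: by end_near. Qed.

Lemma innerxx_ge0 x : 0 <= inner x x.
Proof. by rewrite inner_norm2 -of_real0 le_of_real sqr_ge0. Qed.

Lemma modulus_inner x y : modulus (inner x y) <= norm2 x * norm2 y.
Proof.
rewrite -ler_sqr ?nnegrE ?mulr_ge0 ?modulus_ge0 ?norm2_ge0 //.
have := @psd_form_cauchy_schwarz R s (l2 R s) inner x y
  (@inner_combinationl R s) inner_sym innerxx_ge0.
by rewrite !inner_norm2 !ge0_modulus_of_real ?sqr_ge0 // exprMn.
Qed.

Lemma innerDl x y z : inner (x + y) z = inner x z + inner y z.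
Proof. by have := inner_combinationl 1 x y z; rewrite scale1r mul1r. Qed.

Lemma innerDr x y z : inner z (x + y) = inner z x + inner z y.
Proof. by have := inner_combinationr 1 x y z; rewrite scale1r conjs1 mul1r. Qed.

Lemma innerZl a x z : inner (a *: x) z = a * inner x z.
Proof. by have := inner_combinationl a x 0 z; rewrite inner0l !addr0. Qed.

Lemma innerZr a x z : inner z (a *: x) = conjs a * inner z x.
Proof. by have := inner_combinationr a x 0 z; rewrite inner0r !addr0. Qed.

Lemma innerBl x y z : inner (x - y) z = inner x z - inner y z.
Proof. by rewrite innerDl -scaleN1r innerZl mulN1r. Qed.

Lemma inner_suml (I : Type) (t : seq I) (P : pred I) (u : I -> l2 R s) z :
  inner (\sum_(i <- t | P i) u i) z = \sum_(i <- t | P i) inner (u i) z.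
Proof.
elim/big_ind2 : _ => [|x1 x2 y1 y2 <- <-|//]; first exact: inner0l.
by rewrite innerDl.
Qed.

Lemma norm2D x y : norm2 (x + y) <= norm2 x + norm2 y.
Proof.
rewrite -ler_sqr ?nnegrE ?addr_ge0 ?norm2_ge0 // -(@le_of_real R s) -inner_norm2.
rewrite [inner _ _]ge0_of_real ?innerxx_ge0 // le_of_real.
rewrite innerDl !innerDr.
apply: le_trans (modulusD _ _) _.
apply: le_trans (lerD (modulusD _ _) (modulusD _ _)) _.
have := modulus_inner x x; have := modulus_inner y y.
have := modulus_inner x y; have := modulus_inner y x; lra.
Qed.

Lemma norm2Z a x : norm2 (a *: x) = modulus a * norm2 x.
Proof.
apply/eqP; rewrite -(@eqrXn2 _ 2) ?mulr_ge0 ?modulus_ge0 ?norm2_ge0 //.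
apply/eqP/(@of_real_inj R s); rewrite -inner_norm2 innerZl innerZr mulrA mul_conjs.
by rewrite inner_norm2 -of_realM exprMn.
Qed.

Lemma norm2N x : norm2 (- x) = norm2 x.
Proof. by rewrite -scaleN1r norm2Z modulusN modulus1 mul1r. Qed.

Lemma norm20 : norm2 (0 : l2 R s) = 0.
Proof. by rewrite -(scale0r 0) norm2Z modulus0 mul0r. Qed.

Lemma sum_delta (f : nat -> scalar R s) k n : (k < n)%N ->
  \sum_(j < n) f j * (j == k :> nat)%:R = f k.
Proof.
move=> kn; rewrite (bigD1 (Ordinal kn)) //= eqxx mulr1 big1 ?addr0 // => j jk.
rewrite (_ : (_ == _) = false) ?mulr0 //.
by apply: contraNF jk => /eqP jk; apply/eqP/val_inj.
Qed.

Lemma inner_delta x k : inner x (delta k) = x k.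
Proof.
apply: inner_unique; apply: (@cvg_near_cst _ _ _ _ _).
exists k.+1 => // n /= kn; rewrite -(@sum_delta (fun j => x j) k n kn).
apply: eq_bigr => j _; rewrite /delta /=.
by case: (_ == _); rewrite ?conjs1 ?conjs0.
Qed.

Lemma delta_inner x k : inner (delta k) x = conjs (x k).
Proof. by rewrite inner_sym inner_delta. Qed.

Lemma sum_sqr_le n (f : nat -> R) : (forall k, 0 <= f k) ->
  \sum_(k < n) f k ^+ 2 <= (\sum_(k < n) f k) ^+ 2.
Proof.
move=> f0; elim: n => [|n ih]; first by rewrite !big_ord0 expr0n.
rewrite !big_ord_recr /= sqrrD -addrA lerD // lerDr mulrn_wge0 // mulr_ge0 //.
exact: sumr_ge0.
Qed.

Lemma bounded_cvg_series (f : nat -> R) (c : R) : (forall k, 0 <= f k) ->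
  (forall n, \sum_(k < n) f k <= c) -> cvgn (series f) /\ limn (series f) <= c.
Proof.
move=> f0 fc; have cf : cvgn (series f).
  apply: nondecreasing_is_cvgn.
    by apply: (nondecreasing_series (P := xpredT)) => n _ _; exact: f0.
  by exists c => _ [n _ <-]; rewrite /series /= big_mkord.
split=> //; apply: limr_le => //; apply: nearW => n.
by rewrite /series /= big_mkord.
Qed.

Lemma psum_le_lim (f : nat -> R) n : (forall k, 0 <= f k) ->
  cvgn (series f) -> \sum_(k < n) f k <= limn (series f).
Proof.
move=> f0 cf; have := nondecreasing_cvgn_le _ cf n; rewrite /series /= big_mkord.
apply; apply: (nondecreasing_series (P := xpredT)) => k _ _; exact: f0.
Qed.

(** For nonnegative terms the sum of the squares is at most the square of the sum. This is how a
    family of coordinates with a uniform ell_1 bound becomes a vector of [l2]. *)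
Lemma l1_l2 (f : nat -> scalar R s) (c : R) :
  (forall n, \sum_(k < n) modulus (f k) <= c) -> f \in @l2_pred R s.
Proof.
move=> fc; apply/asboolP.
apply: (proj1 (@bounded_cvg_series _ (c ^+ 2) _ _)) => [k|n]; first exact: sqr_ge0.
apply: le_trans (sum_sqr_le _ (fun k => modulus_ge0 _)) _.
have c0 : 0 <= c by have := fc 0%N; rewrite big_ord0.
rewrite ler_sqr ?nnegrE //; apply: sumr_ge0 => k _; exact: modulus_ge0.
Qed.

Lemma l1_bound x (c : R) : (forall n, \sum_(k < n) modulus (x k) <= c) ->
  in_l1 x /\ norm1 x <= c.
Proof. by apply: bounded_cvg_series => k; exact: modulus_ge0. Qed.

Lemma psum_le_norm1 x n : in_l1 x -> \sum_(k < n) modulus (x k) <= norm1 x.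
Proof. by apply: psum_le_lim => k; exact: modulus_ge0. Qed.

Lemma norm2_le x (c : R) : (forall n, \sum_(k < n) modulus (x k) <= c) -> norm2 x <= c.
Proof.
move=> xc; have c0 : 0 <= c by have := xc 0%N; rewrite big_ord0.
rewrite -ler_sqr ?nnegrE ?norm2_ge0 //.
have := cvg_norm2 x => h; rewrite -(cvg_lim _ h) //; apply: limr_le.
  by apply/cvg_ex; exists (norm2 x ^+ 2).
apply: nearW => n; apply: le_trans (sum_sqr_le _ (fun k => modulus_ge0 _)) _.
rewrite ler_sqr ?nnegrE //; apply: sumr_ge0 => k _; exact: modulus_ge0.
Qed.

Lemma norm2_le_norm1 x : in_l1 x -> norm2 x <= norm1 x.
Proof. by move=> x1; apply: norm2_le => n; exact: psum_le_norm1. Qed.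

Lemma norm1_ge0 x : in_l1 x -> 0 <= norm1 x.
Proof. by move=> /(psum_le_norm1 0); rewrite big_ord0. Qed.

Lemma l1_combination a x y : in_l1 x -> in_l1 y ->
  in_l1 (a *: x + y) /\ norm1 (a *: x + y) <= modulus a * norm1 x + norm1 y.
Proof.
move=> x1 y1; apply: l1_bound => n.
apply: (@le_trans _ _ (modulus a * (\sum_(k < n) modulus (x k)) +
                       \sum_(k < n) modulus (y k))).
  rewrite mulr_sumr -big_split /=; apply: ler_sum => k _.
  by rewrite -modulusM modulusD.
by rewrite lerD ?ler_wpM2l ?modulus_ge0 ?psum_le_norm1.
Qed.

Lemma in_l10 : in_l1 (0 : l2 R s) /\ norm1 (0 : l2 R s) = 0.
Proof.
have [h h'] : in_l1 (0 : l2 R s) /\ norm1 (0 : l2 R s) <= 0.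
  by apply: l1_bound => n; rewrite big1 // => k _; exact: modulus0.
by split=> //; apply/eqP; rewrite eq_le h' norm1_ge0.
Qed.

Lemma l1Z a x : in_l1 x -> in_l1 (a *: x) /\ norm1 (a *: x) <= modulus a * norm1 x.
Proof.
by move=> /(l1_combination a)/(_ (proj1 in_l10)); rewrite addr0 (proj2 in_l10) addr0.
Qed.

Lemma l1D x y : in_l1 x -> in_l1 y -> in_l1 (x + y) /\ norm1 (x + y) <= norm1 x + norm1 y.
Proof. by move=> /(l1_combination 1) h /h; rewrite scale1r modulus1 mul1r. Qed.

Lemma l1_delta k : in_l1 (delta k : l2 R s) /\ norm1 (delta k : l2 R s) <= 1.
Proof.
apply: l1_bound => n; case: (ltnP k n) => kn.
  rewrite (bigD1 (Ordinal kn)) //= eqxx modulus1 big1 ?addr0 // => j jk.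
  rewrite (_ : (_ == _) = false) ?modulus0 //.
  by apply: contraNF jk => /eqP jk; apply/eqP/val_inj.
rewrite big1 // => j _; rewrite /delta /= (_ : (_ == _) = false) ?modulus0 //.
by apply: contraTF kn => /eqP <-; rewrite -ltnNge.
Qed.

Lemma rank1E x v k : rank1 x v k = inner v x * x k.
Proof. by []. Qed.

Lemma rank1_self_adjoint x v y : inner (rank1 x v) y = inner v (rank1 x y).
Proof. by rewrite /rank1 innerZl innerZr -inner_sym mulrC. Qed.

Lemma rank1_quadratic x v : inner (rank1 x v) v = of_real (modulus (inner v x) ^+ 2).
Proof. by rewrite /rank1 innerZl [inner x v]inner_sym mul_conjs. Qed.

Lemma modulus_le_norm2 x k : modulus (x k) <= norm2 x.
Proof.
rewrite -inner_delta; apply: le_trans (modulus_inner _ _) _.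
have [d1 d2] := l1_delta k.
by rewrite ler_piMr ?norm2_ge0 // (le_trans (norm2_le_norm1 d1)).
Qed.

End l2_theory.

Lemma nneseries_le (R : realType) (f : nat -> \bar R) (c : \bar R) :
  (forall k, 0 <= f k)%E -> (forall n, \sum_(k < n) f k <= c)%E ->
  (\sum_(0 <= k <oo) f k <= c)%E.
Proof.
move=> f0 fc; apply: lime_le; first by apply: is_cvg_nneseries => n _ _.
by apply: nearW => n; rewrite big_mkord.
Qed.

Lemma sum2_leq (R : realType) (f : nat -> nat -> R) m n :
  (forall k l, 0 <= f k l) -> (m <= n)%N ->
  \sum_(k < m) \sum_(l < m) f k l <= \sum_(k < n) \sum_(l < n) f k l.
Proof.
move=> f0 mn; rewrite (big_ord_widen n (fun k => \sum_(l < m) f k l)) //.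
rewrite big_mkcond; apply: ler_sum => k _; case: ifP => _; last exact: sumr_ge0.
rewrite (big_ord_widen n (f k)) // big_mkcond; apply: ler_sum => l _.
by case: ifP.
Qed.

(** * Entries of operators in [V], and decompositions into rank-one operators *)

Section operators.
Context {R : realType} {s : scalar_kind}.
Implicit Types (x y z v w : l2 R s) (a : scalar R s) (A B : V R s).

Lemma norm11E (T : l2 R s -> l2 R s) : norm11 T =
  (\sum_(0 <= k <oo) \sum_(0 <= l <oo) (modulus (T (delta k) l))%:E)%E.
Proof.
rewrite nneseries_esumT; last first.
  by move=> n; apply: nneseries_ge0 => *; rewrite lee_fin modulus_ge0.
under eq_esum => i _.
  rewrite nneseries_esumT; last by move=> n; rewrite lee_fin modulus_ge0.
  over.
rewrite esum_esum; last by move=> *; rewrite lee_fin modulus_ge0.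
rewrite /norm11; congr (esum _ _).
  by apply/seteqP; split=> // -[].
by apply/funext => -[k l] /=; rewrite inner_delta.
Qed.

(** Square partial sums suffice: each n x m rectangle of entries lies in the square of side
    [maxn n m]. *)
Lemma norm11_le (T : l2 R s -> l2 R s) (c : R) :
  (forall n, \sum_(k < n) \sum_(l < n) modulus (T (delta k) l) <= c) ->
  (norm11 T <= c%:E)%E.
Proof.
move=> Tc; rewrite norm11E; have T0 k l : (0 <= (modulus (T (delta k) l))%:E)%E.
  by rewrite lee_fin modulus_ge0.
apply: nneseries_le => [k|n]; first exact: nneseries_ge0.
rewrite -(big_mkord xpredT (fun k => \sum_(0 <= l <oo) (modulus (T (delta k) l))%:E)%E).
rewrite -nneseries_sum_nat //; apply: nneseries_le => [k|m].
  exact: sume_ge0.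
under eq_bigr do rewrite big_mkord sumEFin.
rewrite sumEFin lee_fin exchange_big /=.
apply: le_trans (Tc (maxn n m)).
apply: (@le_trans _ _ (\sum_(k < maxn n m) \sum_(l < m) modulus (T (delta k) l))).
  rewrite (big_ord_widen (maxn n m) (fun k => \sum_(l < m) modulus (T (delta k) l)))
    ?leq_maxl // big_mkcond.
  apply: ler_sum => k _; case: ifP => // _.
  by apply: sumr_ge0 => l _; exact: modulus_ge0.
apply: ler_sum => k _.
rewrite (big_ord_widen (maxn n m) (fun l => modulus (T (delta k) l))) ?leq_maxr //.
rewrite big_mkcond; apply: ler_sum => l _; case: ifP => // _; exact: modulus_ge0.
Qed.

Lemma norm11_ge (T : l2 R s -> l2 R s) m n :
  ((\sum_(k < n) \sum_(l < m) modulus (T (delta k) l))%:E <= norm11 T)%E.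
Proof.
rewrite norm11E; have T0 k l : (0 <= (modulus (T (delta k) l))%:E)%E.
  by rewrite lee_fin modulus_ge0.
have S0 k : (0 <= \sum_(0 <= l <oo) (modulus (T (delta k) l))%:E)%E.
  exact: nneseries_ge0.
apply: le_trans (@nneseries_lim_ge _ _ xpredT 0%N n _) => //.
rewrite -sumEFin big_mkord; apply: lee_sum => k _.
apply: le_trans (@nneseries_lim_ge _ _ xpredT 0%N m _) => //.
by rewrite -sumEFin big_mkord.
Qed.

Lemma norm11_ge0 (T : l2 R s -> l2 R s) : (0 <= norm11 T)%E.
Proof. by apply: esum_ge0 => *; rewrite lee_fin modulus_ge0. Qed.

Lemma fine_norm11 A : (fine (norm11 A))%:E = norm11 A.
Proof.
have /asboolP[_ _ _ Afin] := V_opP A.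
by rewrite fineK // ge0_fin_numE // norm11_ge0.
Qed.

Lemma V_spec A : [/\ linear A, bounded_op A, self_adjoint A & (norm11 A < +oo)%E].
Proof. by apply/asboolP; exact: V_opP. Qed.

Lemma V_linear A a x y : A (a *: x + y) = a *: A x + A y.
Proof. by case: (V_spec A) => h _ _ _; rewrite h. Qed.

Lemma V_self_adjoint A x y : inner (A x) y = inner x (A y).
Proof. by case: (V_spec A). Qed.

Lemma V_addE A B x : (A + B) x = A x + B x. Proof. by []. Qed.

Lemma V_subE A B x : (A - B) x = A x - B x. Proof. by []. Qed.

Lemma V_coord A x k : A x k = inner x (A (delta k)).
Proof. by rewrite -V_self_adjoint inner_delta. Qed.

Lemma V_ext A B : (forall x k, A x k = B x k) -> A = B.
Proof. by move=> AB; apply: val_inj; apply/funext => x; apply: l2_ext; exact: AB. Qed.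

Lemma V_hermitian A x y : inner (A y) x = conjs (inner (A x) y).
Proof. by rewrite V_self_adjoint inner_sym. Qed.

Lemma Gamma_cauchy_schwarz A x y : Gamma A ->
  modulus (inner (A x) y) ^+ 2 <= modulus (inner (A x) x) * modulus (inner (A y) y).
Proof.
move=> GA; apply: (@psd_form_cauchy_schwarz R s _ (fun x y => inner (A x) y)) => //.
  by move=> a u v w; rewrite V_linear inner_combinationl.
by move=> u v; rewrite V_hermitian.
Qed.

(** A concrete form of the bound [gamma_plus A <= c], with an explicit decomposition and real
    partial sums instead of an infimum of extended reals. As the infimum may not be attained, the
    way back from [gamma_plus] starts from a strict inequality. *)
Definition decomposable A (c : R) := exists x : nat -> l2 R s,
  [/\ forall k, in_l1 (x k), strong_sum x A &
      forall n, \sum_(k < n) norm1 (x k) ^+ 2 <= c].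

Lemma decomposable_gamma_plus A (c : R) :
  decomposable A c -> (gamma_plus A <= c%:E)%E.
Proof.
move=> [x [x1 xA xc]].
apply: le_trans (_ : (\sum_(0 <= k <oo) ((norm1 (x k)) ^+ 2)%:E <= _)%E).
  by apply: ereal_inf_lbound; exists x.
apply: nneseries_le => [k|n]; first by rewrite lee_fin sqr_ge0.
by rewrite sumEFin lee_fin.
Qed.

Lemma gamma_plus_decomposable A (e : \bar R) : (gamma_plus A < e)%E ->
  exists c : R, (c%:E < e)%E /\ decomposable A c.
Proof.
move=> /ereal_inf_lt[_ [x [x1 xA] <-]] lt.
have x0 k : (0 <= ((norm1 (x k)) ^+ 2)%:E)%E by rewrite lee_fin sqr_ge0.
have t0 : (0 <= \sum_(0 <= k <oo) ((norm1 (x k)) ^+ 2)%:E)%E by exact: nneseries_ge0.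
have tfin : (\sum_(0 <= k <oo) ((norm1 (x k)) ^+ 2)%:E)%E \is a fin_num.
  by rewrite ge0_fin_numE // (lt_le_trans lt) // leey.
exists (fine (\sum_(0 <= k <oo) ((norm1 (x k)) ^+ 2)%:E)%E).
rewrite fineK //; split=> //; exists x; split=> // n.
rewrite -lee_fin fineK // -sumEFin -(big_mkord xpredT (fun k => ((norm1 (x k)) ^+ 2)%:E)).
exact: nneseries_lim_ge.
Qed.

Lemma strong_sum_inner (x : nat -> l2 R s) A v w : strong_sum x A ->
  (fun n => \sum_(k < n) inner (rank1 (x k) v) w) @ \oo --> inner (A v) w.
Proof.
move=> /(_ v) xA; apply/cvg_modulusP.
apply: (@squeeze_cvgr _ _ _ _ (fun=> 0)
  (fun n => norm2 (\sum_(k < n) rank1 (x k) v - A v) * norm2 w)).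
- apply: nearW => n; rewrite modulus_ge0 -inner_suml -innerBl; exact: modulus_inner.
- exact: cvg_cst.
- by rewrite -[X in _ --> X](mul0r (norm2 w)); apply: cvgM => //; exact: cvg_cst.
Qed.

(** The value [<Av, v>] is the sum of the [|<v, x_k>|^2], each at most [|v|^2] times the square of
    the ell_1 norm of [x_k]. The lower bound puts [A] in [Gamma]; the upper one makes perturbations
    from [U_ e] small when [Gamma] is shown to be closed. *)
Lemma decomposable_quadratic A (c : R) v : decomposable A c ->
  exists q : R, [/\ inner (A v) v = of_real q, 0 <= q & q <= c * norm2 v ^+ 2].
Proof.
move=> [x [x1 xA xc]].
pose q n : R := \sum_(k < n) modulus (inner v (x k)) ^+ 2.
have h := @strong_sum_inner _ _ v v xA.
have hq n : \sum_(k < n) inner (rank1 (x k) v) v = of_real (q n).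
  by rewrite of_real_sum; apply: eq_bigr => k _; rewrite rank1_quadratic.
have qb n : 0 <= q n <= c * norm2 v ^+ 2.
  apply/andP; split; first by apply: sumr_ge0 => k _; exact: sqr_ge0.
  apply: le_trans (_ : (\sum_(k < n) norm1 (x k) ^+ 2) * norm2 v ^+ 2 <= _); last first.
    by apply: ler_wpM2r; rewrite ?sqr_ge0.
  rewrite mulr_suml; apply: ler_sum => k _; rewrite -exprMn.
  rewrite ler_sqr ?nnegrE ?mulr_ge0 ?modulus_ge0 ?norm2_ge0 ?norm1_ge0 //.
  apply: le_trans (modulus_inner _ _) _; rewrite mulrC ler_wpM2r ?norm2_ge0 //.
  exact: norm2_le_norm1.
have hm : q @ \oo --> modulus (inner (A v) v).
  apply: cvg_trans (cvg_modulus h); apply: near_eq_cvg; near=> n.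
  rewrite hq ge0_modulus_of_real //; by case/andP: (qb n).
exists (modulus (inner (A v) v)); split; last 2 first.
- exact: modulus_ge0.
- rewrite -(cvg_lim _ hm) //; apply: limr_le; first by apply: cvgP hm.
  by apply: nearW => n; case/andP: (qb n).
apply: (@norm_cvg_unique _ _ _ _ _ _ h); apply: cvg_trans (cvg_of_real hm).
by apply: near_eq_cvg; near=> n; rewrite hq.
Unshelve. all: by end_near. Qed.

Lemma decomposable_Gamma A (c : R) : decomposable A c -> Gamma A.
Proof.
move=> Ac v; have [q [-> q0 _]] := decomposable_quadratic v Ac.
by rewrite -of_real0 le_of_real.
Qed.

Lemma Gamma_plusP A : Gamma_plus A <-> exists c, decomposable A c.
Proof.
split=> [[_ /gamma_plus_decomposable[c [_ h]]]|[c h]]; first by exists c.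
split; first exact: decomposable_Gamma h.
by apply: le_lt_trans (decomposable_gamma_plus h) _; rewrite ltry.
Qed.

Lemma U_P (e : R) A : U_ e A <-> exists2 c, c < e & decomposable A c.
Proof.
split=> [[_ /gamma_plus_decomposable[c [ce h]]]|[c ce h]]; first by exists c.
split; first by apply/Gamma_plusP; exists c.
by apply: le_lt_trans (decomposable_gamma_plus h) _; rewrite lte_fin.
Qed.

Lemma decomposable0 : decomposable 0 0.
Proof.
exists (fun=> 0); split=> [k|v|n]; first exact: (proj1 in_l10).
  rewrite (_ : (fun _ => _) = fun=> 0); first exact: cvg_cst.
  apply/funext => n; rewrite big1 ?subr0 ?norm20 // => k _.
  by rewrite /rank1 scaler0.
by rewrite big1 // => k _; rewrite (proj2 in_l10) expr0n.
Qed.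

(** Among the indices below n, [uphalf n] are even and [n./2] are odd. *)
Lemma sum_interleave (M : nmodType) (f g : nat -> M) n :
  \sum_(k < n) (if odd k then g k./2 else f k./2) =
  \sum_(k < uphalf n) f k + \sum_(k < n./2) g k.
Proof.
elim: n => [|n ih]; first by rewrite !big_ord0 addr0.
rewrite big_ord_recr /= ih uphalf_half; case: ifP => on /=.
  by rewrite add1n big_ord_recr /= big_ord_recr /= addrA.
by rewrite add0n big_ord_recr /= addrAC.
Qed.

Lemma cvg_half : (fun n => n./2) @ \oo --> \oo.
Proof.
move=> P [N _ NP]; exists N.*2 => // n /= Nn; apply: NP => /=.
by rewrite -(doubleK N) half_leq.
Qed.

Lemma cvg_uphalf : (fun n => uphalf n) @ \oo --> \oo.
Proof.
move=> P [N _ NP]; exists N.*2 => // n /= Nn; apply: NP => /=.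
by rewrite -(doubleK N) uphalf_half (leq_trans (half_leq Nn)) // leq_addl.
Qed.

(** Subadditivity of the cost. The two sequences are interleaved, so every partial sum of the result
    is a partial sum for [A] plus one for [B], with both lengths tending to infinity. *)
Lemma decomposableD A B (c d : R) :
  decomposable A c -> decomposable B d -> decomposable (A + B) (c + d).
Proof.
move=> [x [x1 xA xc]] [y [y1 yB yd]].
exists (fun k => if odd k then y k./2 else x k./2); split=> [k|v|n].
- by case: ifP.
- apply: (@squeeze_cvgr _ _ _ _ (fun=> 0)
    (fun n => norm2 (\sum_(k < uphalf n) rank1 (x k) v - A v) +
              norm2 (\sum_(k < n./2) rank1 (y k) v - B v))); last 2 first.
  + exact: cvg_cst.
  + rewrite -[X in _ --> X](addr0 0); apply: cvgD.
      exact: (cvg_comp _ _ cvg_uphalf (xA v)).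
    exact: (cvg_comp _ _ cvg_half (yB v)).
  apply: nearW => n; rewrite norm2_ge0 andTb.
  have -> : \sum_(k < n) rank1 (if odd k then y k./2 else x k./2) v =
      \sum_(k < n) (if odd k then rank1 (y k./2) v else rank1 (x k./2) v).
    by apply: eq_bigr => k _; case: ifP.
  rewrite (sum_interleave (fun k => rank1 (x k) v) (fun k => rank1 (y k) v)).
  by rewrite V_addE opprD addrACA norm2D.
have -> : \sum_(k < n) norm1 (if odd k then y k./2 else x k./2) ^+ 2 =
    \sum_(k < n) (if odd k then norm1 (y k./2) ^+ 2 else norm1 (x k./2) ^+ 2).
  by apply: eq_bigr => k _; case: ifP.
rewrite (sum_interleave (fun k => norm1 (x k) ^+ 2) (fun k => norm1 (y k) ^+ 2)).
exact: lerD.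
Qed.

End operators.

Lemma cvg_ord_sum (K : numFieldType) (m : nat) (u : nat -> nat -> K) (l : nat -> K) :
  (forall k, (fun n => u n k) @ \oo --> l k) ->
  (fun n => \sum_(k < m) u n k) @ \oo --> \sum_(k < m) l k.
Proof.
move=> ul; elim: m => [|m ih].
  rewrite big_ord0 (_ : (fun _ => _) = fun=> 0); first exact: cvg_cst.
  by apply/funext => n; rewrite big_ord0.
rewrite big_ord_recr /= (_ : (fun _ => _) = (fun n => \sum_(k < m) u n k + u n m)).
  by apply: cvgD.
by apply/funext => n; rewrite big_ord_recr.
Qed.

(** * Summing a series of rank-one operators of finite cost to an element of [V] *)

Section synthesis.
Context {R : realType} {s : scalar_kind}.
Variables (x : nat -> l2 R s) (c : R).
Hypothesis x1 : forall k, in_l1 (x k).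
Hypothesis xc : forall n, \sum_(k < n) norm1 (x k) ^+ 2 <= c.
Implicit Types (v w : l2 R s) (m n N M : nat).

Let psum n v := \sum_(j < n) rank1 (x j) v.
Let cost n : R := \sum_(j < n) norm1 (x j) ^+ 2.
Let total : R := limn (series (fun j => norm1 (x j) ^+ 2)).

Let cost_cvg : cvgn (series (fun j => norm1 (x j) ^+ 2)).
Proof. by apply: (proj1 (bounded_cvg_series _ xc)) => k; exact: sqr_ge0. Qed.

Let cost_le n : cost n <= total.
Proof. by apply: psum_le_lim => // k; exact: sqr_ge0. Qed.

Let cvg_cost : cost @ \oo --> total.
Proof.
apply: cvg_trans cost_cvg; apply: near_eq_cvg; near=> n.
by rewrite /series /= big_mkord.
Unshelve. all: by end_near. Qed.

Let psumE n v m : psum n v m = \sum_(j < n) inner v (x j) * x j m.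
Proof. by rewrite /psum l2_sumE. Qed.

Let psumS n v m : psum n.+1 v m = psum n v m + inner v (x n) * x n m.
Proof. by rewrite !psumE big_ord_recr. Qed.

Let modulus_inner_l1 v j : modulus (inner v (x j)) <= norm2 v * norm1 (x j).
Proof.
apply: le_trans (modulus_inner _ _) _.
by rewrite ler_wpM2l ?norm2_ge0 // norm2_le_norm1.
Qed.

(** The j-th term adds at most [|<v, x_j>|] times the ell_1 norm of [x_j], hence at most [norm2 v]
    times its cost. The bound is independent of [M], so it survives the limit in each coordinate and
    then controls full ell_1 norms. *)
Let psum_diff v n d M :
  \sum_(m < M) modulus (psum (n + d) v m - psum n v m) <=
  norm2 v * (cost (n + d) - cost n).
Proof.
elim: d => [|d ih].
  by rewrite addn0 subrr mulr0 big1 // => m _; rewrite subrr modulus0.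
rewrite addnS; apply: le_trans (_ : \sum_(m < M)
   (modulus (psum (n + d) v m - psum n v m) +
    modulus (inner v (x (n + d))) * modulus (x (n + d) m)) <= _).
  by apply: ler_sum => m _; rewrite -modulusM psumS addrAC modulusD.
rewrite big_split /= -mulr_sumr.
have -> : norm2 v * (cost (n + d).+1 - cost n) =
    norm2 v * (cost (n + d) - cost n) + norm2 v * norm1 (x (n + d)) * norm1 (x (n + d)).
  by rewrite /cost big_ord_recr /=; ring.
apply: lerD ih _; apply: ler_pM => //; first exact: modulus_ge0.
  by apply: sumr_ge0 => m _; exact: modulus_ge0.
exact: psum_le_norm1.
Qed.

Let psum_cvg v m : cvgn (fun n => psum n v m).
Proof.
have h : cvgn (series (fun j => inner v (x j) * x j m)).
  apply: modulus_cvg; apply: (proj1 (@bounded_cvg_series _ _ (norm2 v * total) _ _)).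
    by move=> k; exact: modulus_ge0.
  move=> n; apply: le_trans (ler_wpM2l (norm2_ge0 v) (cost_le n)).
  rewrite mulr_sumr; apply: ler_sum => j _; rewrite modulusM expr2 mulrA.
  apply: ler_pM; rewrite ?modulus_ge0 //.
  exact: le_trans (modulus_le_norm2 _ _) (norm2_le_norm1 _).
apply: cvgP; apply: cvg_trans h; apply: near_eq_cvg; near=> n.
by rewrite psumE /series /= big_mkord.
Unshelve. all: by end_near. Qed.

Let image v m : scalar R s := limn (fun n => psum n v m).

Let cvg_image v m : (fun n => psum n v m) @ \oo --> image v m.
Proof. exact: psum_cvg. Qed.

Let image_diff v n M :
  \sum_(m < M) modulus (image v m - psum n v m) <= norm2 v * (total - cost n).
Proof.
have h : (fun N => \sum_(m < M) modulus (psum N v m - psum n v m)) @ \oo -->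
    \sum_(m < M) modulus (image v m - psum n v m).
  apply: (@cvg_ord_sum R M (fun N m => modulus (psum N v m - psum n v m))
    (fun m => modulus (image v m - psum n v m))) => m.
  by apply: cvg_modulus; apply: cvgB; [exact: cvg_image|exact: cvg_cst].
(* With [M] fixed, the upper index of the estimate on partial sums goes to infinity. *)
rewrite -(cvg_lim _ h) //; apply: limr_le; first by apply: cvgP h.
exists n => // N /= nN; rewrite -(subnKC nN); apply: le_trans (psum_diff _ _ _ _) _.
by rewrite ler_wpM2l ?norm2_ge0 // lerD2r.
Qed.

Let image_bound v M : \sum_(m < M) modulus (image v m) <= norm2 v * total.
Proof.
have := image_diff v 0 M; rewrite /cost big_ord0 subr0; apply: le_trans.
apply: ler_sum => m _; by rewrite psumE big_ord0 subr0.
Qed.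

Let op v : l2 R s := L2 (l1_l2 (image_bound v)).

Let op_norm v : norm2 (op v) <= norm2 v * total.
Proof. exact/norm2_le/image_bound. Qed.

Let op_diff v n : norm2 (psum n v - op v) <= norm2 v * (total - cost n).
Proof.
rewrite -norm2N opprB; apply: norm2_le => M; exact: image_diff.
Qed.

Let op_strong v : (fun n => norm2 (psum n v - op v)) @ \oo --> (0 : R).
Proof.
apply: (@squeeze_cvgr _ _ _ _ (fun=> 0) (fun n => norm2 v * (total - cost n))).
- by apply: nearW => n; rewrite norm2_ge0 op_diff.
- exact: cvg_cst.
- rewrite -[X in _ --> X](mulr0 (norm2 v)) -(subrr total).
  by apply: cvgM; [exact: cvg_cst|apply: cvgB => //; exact: cvg_cst].
Qed.

Let op_linear : linear op.
Proof.
move=> a u w; apply: l2_ext => m.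
apply: (@norm_cvg_unique _ _ _ _ _ _ (@cvg_image (a *: u + w) m)).
have h : (fun n => a * psum n u m + psum n w m) @ \oo --> a * image u m + image w m.
  by apply: cvgD (@cvg_image w m); apply: cvgM (@cvg_image u m); exact: cvg_cst.
apply: cvg_trans h; apply: near_eq_cvg; near=> n.
rewrite !psumE mulr_sumr -big_split /=; apply: eq_bigr => j _.
by rewrite inner_combinationl mulrDl mulrA.
Unshelve. all: by end_near. Qed.

Let op_inner v w : (fun n => inner (psum n v) w) @ \oo --> inner (op v) w.
Proof.
apply/cvg_modulusP; apply: (@squeeze_cvgr _ _ _ _ (fun=> 0)
  (fun n => norm2 (psum n v - op v) * norm2 w)).
- by apply: nearW => n; rewrite modulus_ge0 -innerBl modulus_inner.
- exact: cvg_cst.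
- by rewrite -[X in _ --> X](mul0r (norm2 w)); apply: cvgM (op_strong v) _; exact: cvg_cst.
Qed.

Let op_self_adjoint : self_adjoint op.
Proof.
move=> v w; apply: (@norm_cvg_unique _ _ _ _ _ _ (@op_inner v w)).
rewrite inner_sym; apply: cvg_trans (cvg_conjs (@op_inner w v)).
apply: near_eq_cvg; near=> n; rewrite -inner_sym.
rewrite [in LHS]inner_sym /psum !inner_suml conjs_sum; apply: eq_bigr => j _.
by rewrite rank1_self_adjoint -inner_sym.
Unshelve. all: by end_near. Qed.

(** The (k, l) entry of [x_j x_j^*] has modulus [|x_j k| |x_j l|], so its entries sum to at most the
    cost of [x_j]. On a finite square of entries this bound passes to the limit. *)
Let op_norm11 : (norm11 op < +oo)%E.
Proof.
apply: (@le_lt_trans _ _ total%:E); last by rewrite ltry.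
apply: norm11_le => n.
have h : (fun N => \sum_(k < n) \sum_(l < n) modulus (psum N (delta k) l)) @ \oo -->
    \sum_(k < n) \sum_(l < n) modulus (op (delta k) l).
  apply: (@cvg_ord_sum R n (fun N k => \sum_(l < n) modulus (psum N (delta k) l))
    (fun k => \sum_(l < n) modulus (op (delta k) l))) => k.
  apply: (@cvg_ord_sum R n (fun N l => modulus (psum N (delta k) l))
    (fun l => modulus (op (delta k) l))) => l.
  exact: cvg_modulus (@cvg_image _ _).
rewrite -(cvg_lim _ h) //; apply: limr_le; first by apply: cvgP h.
apply: nearW => N; apply: le_trans (cost_le N).
apply: (@le_trans _ _ (\sum_(k < n) \sum_(l < n) \sum_(j < N)
    modulus (x j k) * modulus (x j l))).
  apply: ler_sum => k _; apply: ler_sum => l _; rewrite psumE.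
  apply: le_trans (modulus_sum _ _ _) _; apply: ler_sum => j _.
  by rewrite modulusM delta_inner modulus_conjs.
under eq_bigr do rewrite exchange_big /=.
rewrite exchange_big /=; apply: ler_sum => j _.
have -> : \sum_(k < n) \sum_(l < n) modulus (x j k) * modulus (x j l) =
    (\sum_(k < n) modulus (x j k)) * (\sum_(l < n) modulus (x j l)).
  by rewrite mulr_suml; apply: eq_bigr => k _; rewrite mulr_sumr.
have x0 : 0 <= \sum_(k < n) modulus (x j k).
  by apply: sumr_ge0 => k _; exact: modulus_ge0.
by rewrite expr2; apply: ler_pM => //; exact: psum_le_norm1.
Qed.

Let op_V : op \in @V_pred R s.
Proof.
by apply/asboolP; split=> //; exists total => v; rewrite mulrC.
Qed.

(** The coordinatewise limits are kept alongside the decomposition because they identify [A] later,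
    by uniqueness of limits. *)
Lemma rank1_series : exists A : V R s,
  (forall v m, (fun n => \sum_(j < n) inner v (x j) * x j m) @ \oo --> A v m) /\
  decomposable A c.
Proof.
exists (MkV op_V); split=> [v m|]; last by exists x; split.
by apply: cvg_trans (@cvg_image v m); apply: near_eq_cvg; near=> n; rewrite psumE.
Unshelve. all: by end_near. Qed.

End synthesis.

(** * Decomposing a general operator, and a positive finite matrix *)

Section density.
Context {R : realType} {s : scalar_kind}.
Implicit Types (x y v w : l2 R s) (a : scalar R s) (A B : V R s) (k l m n N : nat).

Lemma cvg_norm1 x : in_l1 x -> (fun n => \sum_(k < n) modulus (x k)) @ \oo --> norm1 x.
Proof.
move=> x1; apply: cvg_trans (_ : series (fun k => modulus (x k)) @ \oo --> norm1 x).
  by apply: near_eq_cvg; near=> n; rewrite /series /= big_mkord.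
exact: x1.
Unshelve. all: by end_near. Qed.

Lemma norm1_eq0 x : in_l1 x -> norm1 x = 0 -> x = 0.
Proof.
move=> x1 x0; apply: l2_ext => k; apply/modulus_eq0/eqP.
by rewrite eq_le modulus_ge0 andbT -x0 (le_trans (modulus_le_norm2 _ _)) ?norm2_le_norm1.
Qed.

Lemma norm11_rows (T : l2 R s -> l2 R s) (c : R) : (norm11 T <= c%:E)%E ->
  (forall k, in_l1 (T (delta k))) /\ forall n, \sum_(k < n) norm1 (T (delta k)) <= c.
Proof.
move=> Tc; have Tb m n : \sum_(k < n) \sum_(l < m) modulus (T (delta k) l) <= c.
  by rewrite -lee_fin; exact: le_trans (norm11_ge _ _ _) Tc.
have T1 k : in_l1 (T (delta k)).
  (* Row k is the last of the first k + 1 rows, whose joint sum is at most [c]. *)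
  apply: (proj1 (@l1_bound _ _ _ c _)) => m; apply: le_trans (Tb m k.+1).
  rewrite big_ord_recr /= lerDr; apply: sumr_ge0 => i _; apply: sumr_ge0 => j _.
  exact: modulus_ge0.
split=> // n.
have h := @cvg_ord_sum R n (fun m k => \sum_(l < m) modulus (T (delta k) l))
  (fun k => norm1 (T (delta k))) (fun k => cvg_norm1 (T1 k)).
by rewrite -(cvg_lim _ h) //; apply: limr_le; [exact: cvgP h|exact: nearW].
Qed.

(* With s_k ^ 2 = norm1 (A delta_k), the rank-one operators of
   c_k = s_k delta_k, w_k = A delta_k / (2 s_k) and c_k + w_k satisfy
   (c_k + w_k)(c_k + w_k)^* - c_k c_k^* - w_k w_k^* =
     (delta_k (A delta_k)^* + (A delta_k) delta_k^* ) / 2,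
   and both halves of the right-hand side sum up to A / 2. When s_k = 0 the
   division gives w_k = 0, consistently with A delta_k = 0. *)
Lemma V_decomposition A (c : R) : (norm11 A <= c%:E)%E ->
  exists B C : V R s,
    [/\ A = B - C, decomposable B (9 / 4 * c) & decomposable C (5 / 4 * c)].
Proof.
move=> /norm11_rows[r1 rc].
(* Here [t], [p] and [q] are the s, c and w of the comment above. Their ell_1 norms satisfy
   [norm1 (p k) <= t k] and [norm1 (q k) <= t k / 2]. The costs are thus [(3/2)^2 = 9/4] for the
   series of [p k + q k], and [1 + 1/4 = 5/4] for those of [p] and [q] together, times [c]. *)
pose r k := A (delta k); pose t k : R := Num.sqrt (norm1 (r k)).
pose p k := of_real (t k) *: delta k : l2 R s.
pose q k := of_real (2 * t k)^-1 *: r k : l2 R s.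
have t0 k : 0 <= t k by exact: sqrtr_ge0.
have t2 k : t k ^+ 2 = norm1 (r k) by rewrite sqr_sqrtr // norm1_ge0 //; exact: r1.
have [p1 pn] : (forall k, in_l1 (p k)) /\ forall k, norm1 (p k) <= t k.
  split=> k; have [d1 d2] := @l1_delta R s k; have [h1 h2] := l1Z (of_real (t k)) d1 => //.
  by apply: le_trans h2 _; rewrite ge0_modulus_of_real // ler_piMr.
have [q1 qn] : (forall k, in_l1 (q k)) /\ forall k, norm1 (q k) <= t k / 2.
  split=> k; have [h1 h2] := l1Z (of_real (2 * t k)^-1) (r1 k) => //.
  apply: le_trans h2 _; rewrite ge0_modulus_of_real ?invr_ge0 ?mulr_ge0 // -t2.
  have [->|tn0] := eqVneq (t k) 0; first by rewrite expr0n mulr0 mul0r.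
  by rewrite le_eqVlt; apply/orP; left; apply/eqP; field.
have [pq1 pqn] : (forall k, in_l1 (p k + q k)) /\
    forall k, norm1 (p k + q k) <= 3 / 2 * t k.
  split=> k; have [h1 h2] := l1D (p1 k) (q1 k) => //.
  by apply: le_trans h2 _; have := pn k; have := qn k; lra.
have costs (u : nat -> l2 R s) (d : R) : (forall k, in_l1 (u k)) -> 0 <= d ->
    (forall k, norm1 (u k) <= d * t k) ->
    forall n, \sum_(k < n) norm1 (u k) ^+ 2 <= d ^+ 2 * c.
  move=> u1 d0 ud n; apply: le_trans (ler_wpM2l (sqr_ge0 d) (rc n)).
  rewrite mulr_sumr; apply: ler_sum => k _; rewrite -t2 -exprMn.
  by rewrite ler_sqr ?nnegrE ?mulr_ge0 ?norm1_ge0.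
have [B [hB dB]] := rank1_series pq1 (costs _ (3 / 2) pq1 (ltac:(lra)) pqn).
have [C [hC dC]] := rank1_series p1 (costs _ 1 p1 (ltac:(lra))
  (fun k => ltac:(rewrite mul1r; exact: pn))).
have [D [hD dD]] := rank1_series q1 (costs _ (1 / 2) q1 (ltac:(lra))
  (fun k => ltac:(rewrite mulrC mulrA mulr1; exact: qn))).
exists B, (C + D); split; last 2 first.
- by have -> : 9 / 4 * c = (3 / 2) ^+ 2 * c by field.
- have -> : 5 / 4 * c = 1 ^+ 2 * c + (1 / 2) ^+ 2 * c by field.
  exact: decomposableD.
have cross v m j : inner v (p j) * q j m + inner v (q j) * p j m =
    of_real (1 / 2) * (v j * conjs (r m j)) +
    of_real (1 / 2) * (inner v (r j) * (j == m)%:R).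
  have rjm : conjs (r m j) = r j m.
    by rewrite -delta_inner -V_self_adjoint inner_delta.
  have [tj0|tj0] := eqVneq (t j) 0.
    have rj0 : r j = 0 by apply: norm1_eq0; [exact: r1|rewrite -t2 tj0 expr0n].
    rewrite rjm /p /q tj0 rj0 of_real0 !scale0r inner0r !scaler0 inner0r.
    by rewrite !mul0r -[(0 : l2 R s) m]/(0 : scalar R s) !mulr0 addr0.
  have half : of_real (t j) * of_real (2 * t j)^-1 = of_real (1 / 2) :> scalar R s.
    by rewrite -of_realM; congr of_real; field.
  rewrite /p /q !innerZr !conjs_real inner_delta rjm -half.
  rewrite -[(_ *: r j) m]/(_ * r j m) -[(_ *: delta j) m]/(_ * (m == j)%:R).
  by rewrite [m == j]eq_sym; ring.
apply: V_ext => v m; rewrite V_subE -[(A v) m]/(A v m).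
have -> : (B v - (C + D) v) m = B v m - C v m - D v m.
  by rewrite V_addE -[LHS]/(B v m - (C v m + D v m)) opprD addrA.
have lhs : (fun n => \sum_(j < n) inner v (p j + q j) * (p j + q j) m -
    \sum_(j < n) inner v (p j) * p j m - \sum_(j < n) inner v (q j) * q j m) @ \oo -->
    B v m - C v m - D v m.
  by apply: cvgB (hD v m); exact: cvgB (hB v m) (hC v m).
apply/esym; apply: (@norm_cvg_unique _ _ _ _ _ _ lhs).
have half1 : (of_real (1 / 2) + of_real (1 / 2) : scalar R s) = 1.
  by rewrite -of_realD -splitr of_real1.
(* The two halves of the cross terms behave differently. The first is a partial sum of
   [<v, A delta_m>], self-adjointness having turned row j into row m, and converges to [A v m]. The
   second has a single possibly nonzero term, at [j = m], and equals [A v m] as soon as [n > m]. *)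
rewrite -[A v m]mul1r -half1 mulrDl.
have h : (fun n => of_real (1 / 2) * (\sum_(j < n) v j * conjs (r m j)) +
    of_real (1 / 2) * A v m) @ \oo --> of_real (1 / 2) * A v m + of_real (1 / 2) * A v m.
  apply: cvgD; last exact: cvg_cst.
  by apply: cvgM; [exact: cvg_cst|rewrite V_coord; exact: cvg_inner].
apply: cvg_trans h; apply: near_eq_cvg; exists m.+1 => // n /= mn.
rewrite -[RHS]/(\sum_(j < n) inner v (p j + q j) * (p j m + q j m) -
  \sum_(j < n) inner v (p j) * p j m - \sum_(j < n) inner v (q j) * q j m).
have -> : A v m = \sum_(j < n) inner v (r j) * (j == m :> nat)%:R.
  by rewrite (@sum_delta R s (fun j => inner v (r j)) m n mn) V_coord.
rewrite !mulr_sumr -!sumrB -big_split /=; apply: eq_bigr => j _.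
by rewrite -cross innerDr; ring.
Qed.

Lemma rank1_decomposable x : in_l1 x ->
  exists B : V R s, (forall v, B v = rank1 x v) /\ decomposable B (norm1 x ^+ 2).
Proof.
move=> x1; pose u k : l2 R s := if k is 0 then x else 0.
have u1 k : in_l1 (u k) by case: k => //= k; exact: (proj1 in_l10).
have uc n : \sum_(k < n) norm1 (u k) ^+ 2 <= norm1 x ^+ 2.
  case: n => [|n]; first by rewrite big_ord0 sqr_ge0.
  rewrite big_ord_recl /= big1 ?addr0 // => k _.
  by rewrite (proj2 in_l10) expr0n.
have [B [hB dB]] := rank1_series u1 uc.
exists B; split=> // v; apply: l2_ext => m; rewrite rank1E.
apply: (@norm_cvg_unique _ _ _ _ _ _ (hB v m)).
apply: cvg_near_cst; exists 1%N => // -[//|n] _ /=.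
by rewrite big_ord_recl /= big1 ?addr0 // => k _; rewrite inner0r mul0r.
Qed.

(* One step of Cholesky elimination: subtracting x x^* with
   x = A delta_n / sqrt <A delta_n, delta_n> leaves a positive operator by the
   Cauchy-Schwarz inequality, and kills the row and the column of index n. *)
Lemma finite_Gamma_decomposable n A :
  Gamma A -> (forall k, (n <= k)%N -> A (delta k) = 0) -> exists c, decomposable A c.
Proof.
elim: n A => [|n ih] A GA A0.
  exists 0; have -> : A = 0; last exact: decomposable0.
  by apply: V_ext => v k; rewrite V_coord A0 // inner0r.
pose e : l2 R s := delta n; pose a := modulus (inner (A e) e).
have aE : inner (A e) e = of_real a by exact/ge0_of_real/GA.
have a0 : 0 <= a by exact: modulus_ge0.
(* If [a = 0] then [b = 0] and nothing is subtracted; the row of index n is already zero, since the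
   Cauchy-Schwarz inequality bounds its entries by [a]. *)
pose b : R := (Num.sqrt a)^-1.
have b2 : b ^+ 2 = a^-1 by rewrite exprVn sqr_sqrtr.
pose x := of_real b *: A e.
have Ae1 : in_l1 (A e).
  have [|h _] := @norm11_rows A (fine (norm11 A)); first by rewrite fine_norm11.
  exact: h.
have [x1 _] := l1Z (of_real b) Ae1; rewrite -/x in x1.
have [B [BE dB]] := rank1_decomposable x1.
suff [c dc] : exists c, decomposable (A - B) c.
  by exists (c + norm1 x ^+ 2); rewrite -(subrK B A); exact: decomposableD.
apply: ih => [v|k nk].
  rewrite V_subE BE innerBl rank1_quadratic [inner (A v) v]ge0_of_real; last exact: GA.
  rewrite -of_realB -of_real0 le_of_real subr_ge0 /x innerZr conjs_real modulusM.
  rewrite exprMn modulus_of_real real_normK ?num_real // b2 -V_self_adjoint.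
  have := Gamma_cauchy_schwarz v e GA; rewrite -/a => cs.
  have [az|az] := eqVneq a 0; first by rewrite az invr0 mul0r modulus_ge0.
  have ap : 0 < a by rewrite lt0r az.
  by rewrite mulrC ler_pdivrMr.
rewrite V_subE BE /rank1 delta_inner.
have -> : x k = of_real b * A e k by [].
(* For [k > n] the coordinate [x k] is a multiple of [<e, A delta_k> = 0], so rows that vanished
   stay zero. The case [k = n] is the row being eliminated. *)
move: nk; rewrite leq_eqVlt => /orP[/eqP <-|nk]; last first.
  by rewrite V_coord A0 // inner0r mulr0 conjs0 scale0r subr0.
rewrite -[A e n]inner_delta -/e aE -of_realM conjs_real /x scalerA -of_realM.
have [az|az] := eqVneq a 0; last first.
  by rewrite mulrAC -expr2 b2 mulVf // of_real1 scale1r subrr.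
have -> : A e = 0; last by rewrite scaler0 subrr.
apply: l2_ext => l; rewrite -inner_delta; apply: modulus_eq0.
have := Gamma_cauchy_schwarz e (delta l) GA; rewrite -/a az mul0r => h.
by apply/eqP; rewrite -sqrf_eq0 eq_le h sqr_ge0.
Qed.

(** * Orthogonal projections onto the first n coordinates, and corners of operators *)

Definition truncate n v : l2 R s := \sum_(k < n) rank1 (delta k) v.

Lemma truncateE n v m : truncate n v m = if (m < n)%N then v m else 0.
Proof.
rewrite l2_sumE; case: ltnP => mn.
  rewrite -(@sum_delta R s (fun j => v j) m n mn); apply: eq_bigr => j _.
  by rewrite rank1E inner_delta /delta /= eq_sym.
rewrite big1 // => j _; rewrite rank1E /delta /= (_ : (_ == _) = false) ?mulr0 //.
by apply: contraTF mn => /eqP ->; rewrite -ltnNge.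
Qed.

Lemma truncate_linear n : linear (truncate n).
Proof.
move=> a v w; apply: l2_ext => m; rewrite truncateE.
rewrite -[RHS]/(a * truncate n v m + truncate n w m) !truncateE.
by case: ifP => // _; rewrite mulr0 addr0.
Qed.

Lemma truncate_self_adjoint n v w : inner (truncate n v) w = inner v (truncate n w).
Proof.
rewrite inner_suml [RHS]inner_sym inner_suml conjs_sum; apply: eq_bigr => k _.
by rewrite rank1_self_adjoint -inner_sym.
Qed.

(** With P the projection, [|Pv|^2 = <v, Pv> <= |v| |Pv|], and [|Pv|] cancels when nonzero. *)
Lemma norm2_truncate n v : norm2 (truncate n v) <= norm2 v.
Proof.
have [->|nz] := eqVneq (norm2 (truncate n v)) 0; first exact: norm2_ge0.
have np : 0 < norm2 (truncate n v) by rewrite lt0r nz norm2_ge0.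
have h : inner (truncate n v) (truncate n v) = inner v (truncate n v).
  rewrite truncate_self_adjoint; congr inner.
  by apply: l2_ext => m; rewrite !truncateE; case: ltnP.
have := modulus_inner v (truncate n v).
by rewrite -h inner_norm2 ge0_modulus_of_real ?sqr_ge0 // expr2 ler_pM2r.
Qed.

Lemma truncate_delta n k : truncate n (delta k) = if (k < n)%N then delta k else 0.
Proof.
apply: l2_ext => m; rewrite truncateE /delta /=.
have [->|mk] := eqVneq m k; first by case: ifP => //= _; rewrite eqxx.
by case: ifP; case: ifP => //=; rewrite (negbTE mk).
Qed.

Lemma compress_entry n A k l : truncate n (A (truncate n (delta k))) l =
  if (k < n)%N && (l < n)%N then A (delta k) l else 0.
Proof.
rewrite truncateE truncate_delta; case: (ltnP k n) => kn /=; first by [].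
by rewrite V_coord inner0l if_same.
Qed.

Lemma compress_V n A : (fun v => truncate n (A (truncate n v))) \in @V_pred R s.
Proof.
have [_ [M AM] _ Afin] := V_spec A; apply/asboolP; split.
- by move=> a v w; rewrite truncate_linear V_linear truncate_linear.
- exists `|M| => v; apply: le_trans (norm2_truncate _ _) _; apply: le_trans (AM _) _.
  apply: le_trans (_ : `|M| * norm2 (truncate n v) <= _).
    by rewrite ler_wpM2r ?norm2_ge0 // ler_norm.
  by rewrite ler_wpM2l // norm2_truncate.
- by move=> v w; rewrite truncate_self_adjoint V_self_adjoint truncate_self_adjoint.
apply: le_lt_trans Afin; apply: le_esum => -[k l] _ /=.
rewrite !inner_delta compress_entry lee_fin; case: ifP => // _.
by rewrite modulus0 modulus_ge0.
Qed.

Definition compress n A : V R s := MkV (compress_V n A).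

Lemma compress_Gamma n A : Gamma A -> Gamma (compress n A).
Proof. by move=> GA v; rewrite /compress /= truncate_self_adjoint; exact: GA. Qed.

Lemma compress_delta n A k : (n <= k)%N -> compress n A (delta k) = 0.
Proof.
move=> nk; apply: l2_ext => l; rewrite [LHS]compress_entry.
by rewrite ltnNge nk.
Qed.

(** The sums [S n] of the moduli of the entries in the n x n corner increase to a limit. Removing
    the corner leaves entries whose moduli sum to at most that limit minus [S n]. *)
Lemma compress_approx A (e : R) : 0 < e ->
  exists n, (norm11 (A - compress n A)%R <= e%:E)%E.
Proof.
move=> e0.
pose S n : R := \sum_(k < n) \sum_(l < n) modulus (A (delta k) l).
have Sb n : S n <= fine (norm11 A).
  by rewrite -lee_fin fine_norm11; exact: norm11_ge.
have Snd : nondecreasing_seq S.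
  move=> m k mk; apply: (@sum2_leq R (fun k l => modulus (A (delta k) l))) => // *.
  exact: modulus_ge0.
have cS : cvgn S.
  by apply: nondecreasing_is_cvgn => //; exists (fine (norm11 A)) => _ [n _ <-].
have SL n := nondecreasing_cvgn_le Snd cS n.
have /cvgrPdist_lt/(_ _ e0)[n _ /(_ n (leqnn n)) Sn] := cS.
exists n; apply: norm11_le => N.
(* The side [N + n] makes the square contain both the N x N square under test and the removed
   corner. *)
apply: (@le_trans _ _ (S (N + n)%N - S n)); last first.
  by have := SL (N + n)%N; move: Sn; rewrite ltr_norml => /andP[_]; lra.
apply: le_trans (_ : \sum_(k < N + n) \sum_(l < N + n)
    modulus ((A - compress n A) (delta k) l) <= _).
  by apply: (@sum2_leq R (fun k l => modulus ((A - compress n A) (delta k) l)))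
    => [k l|]; [exact: modulus_ge0|exact: leq_addr].
have -> : S n = \sum_(k < N + n) \sum_(l < N + n)
    (if (k < n)%N && (l < n)%N then modulus (A (delta k) l) else 0).
  rewrite /S (big_ord_widen (N + n) (fun k => \sum_(l < n) modulus (A (delta k) l)))
    ?leq_addl // big_mkcond; apply: eq_bigr => k _; case: ifP => kn /=.
    rewrite (big_ord_widen (N + n) (fun l => modulus (A (delta k) l))) ?leq_addl //.
    by rewrite big_mkcond.
  by rewrite big1.
rewrite /S -sumrB; apply: ler_sum => k _; rewrite -sumrB; apply: ler_sum => l _.
rewrite -[X in modulus X]/(A (delta k) l - truncate n (A (truncate n (delta k))) l).
rewrite compress_entry; case: ifP => _; last by rewrite !subr0.
by rewrite !subrr modulus0.
Qed.

End density.

(** * Neighbourhoods in the topology of [V], density, closure and reproducibility *)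

Section topology.
Context {R : realType} {s : scalar_kind}.
Implicit Types (A B T : V R s).

Lemma open_translate T (e : R) : 0 < e -> open [set T + B | B in U_ e].
Proof.
move=> e0; exists [set [set T + B | B in U_ e]]; last by rewrite bigcup_set1.
by move=> _ ->; apply: (finI_from1 (D := [set Te : V R s * R | 0 < Te.2])
  (fun Te => [set Te.1 + B | B in U_ Te.2]) (i := (T, e))).
Qed.

(** The translates are given only as a subbase. If [A = T + B] where [B] has cost [c < e],
    subadditivity gives that [A + U_(e - c)] lies in [T + U_e]. For a finite intersection the
    smallest radius is taken, by induction on the list of its members. *)
Lemma open_contains_translate (O : set (V R s)) A : open O -> O A ->
  exists2 e : R, 0 < e & [set A + B | B in U_ e] `<=` O.
Proof.
move=> [F FO <-] [X FX XA].
suff [e e0 eX] : exists2 e : R, 0 < e & [set A + B | B in U_ e] `<=` X.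
  by exists e => // B /eX XB; exists X.
have [G _ GX] := FO _ FX.
pose l : seq (V R s * R) := finmap.enum_fset G.
have XE C : X C <-> forall Te, Te \in l -> [set Te.1 + B | B in U_ Te.2] C.
  by rewrite -GX; split.
have {XA} := (XE A).1 XA.
suff h : (forall Te, Te \in l -> [set Te.1 + B | B in U_ Te.2] A) ->
    exists2 e : R, 0 < e & forall Te, Te \in l ->
      [set A + B | B in U_ e] `<=` [set Te.1 + B | B in U_ Te.2].
  by move=> /h[e e0 el]; exists e => // C CA; apply/XE => Te Tel; exact: el CA.
elim: l {XE} => [|Te l ih] lA; first by exists 1.
have [e e0 el] := ih (fun t tl => lA t (mem_behead (s := Te :: l) tl)).
have [B /U_P[c ce dB] AE] := lA Te (mem_head _ _).
exists (Num.min e (Te.2 - c)); first by rewrite lt_min e0 subr_gt0.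
move=> t; rewrite inE => tl D [C /U_P[d]]; rewrite lt_min => /andP[de dT] dC <-.
case/orP: tl => [/eqP ->|tl]; last by apply: el => //; exists C => //; apply/U_P; exists d.
exists (B + C); last by rewrite addrA AE.
by apply/U_P; exists (c + d); [rewrite addrC -ltrBrDr|exact: decomposableD].
Qed.

Lemma Gamma_approx A (e : R) : Gamma A -> 0 < e ->
  exists2 C, U_ e C & Gamma_plus (A + C).
Proof.
move=> GA e0; have e20 : 0 < e / 2 by rewrite divr_gt0.
have [n /V_decomposition[B [C [AE dB dC]]]] := compress_approx A e20.
have [c dP] := finite_Gamma_decomposable (@compress_Gamma _ _ n A GA)
  (fun k => @compress_delta _ _ n A k).
(* The remainder was taken of norm at most [e / 2] so that [C] costs at most [5 e / 8 < e]. *)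
exists C; first by apply/U_P; exists (5 / 4 * (e / 2)) => //; lra.
apply/Gamma_plusP; exists (c + 9 / 4 * (e / 2)).
have -> : A + C = compress n A + B; last exact: decomposableD.
by rewrite -[B](subrK C) -AE [A - _]addrC !addrA subrr add0r.
Qed.

Lemma U_0 (e : R) : 0 < e -> U_ e (0 : V R s).
Proof. by move=> e0; apply/U_P; exists 0 => //; exact: decomposable0. Qed.

Lemma Gamma_dense : dense_in (@Gamma R s) (@Gamma_plus R s).
Proof.
split=> [A []//|O Oopen [A [OA GA]]].
have [e e0 eO] := open_contains_translate Oopen OA.
have [C UC GAC] := Gamma_approx GA e0.
by exists (A + C); split=> //; apply: eO; exists C.
Qed.

Lemma Gamma_closure : @Gamma R s = closure (@Gamma_plus R s).
Proof.
apply/seteqP; split=> A.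
  move=> GA O; rewrite nbhsE => -[W [Wopen WA] WO].
  have [B [OB GB]] := Gamma_dense.2 _ Wopen (ex_intro _ A (conj WA GA)).
  by exists B; split=> //; exact: WO.
(* The neighbourhood [A + U_e] meets [Gamma_plus] in some [D = A + C]. Then
   [<Av, v> = <Dv, v> - <Cv, v>] is real and at least [- e |v|^2]. *)
move=> cA v; have near (e : R) : 0 < e ->
    exists2 r : R, inner (A v) v = of_real r & - (e * norm2 v ^+ 2) <= r.
  move=> e0; have [|D [/Gamma_plusP[d dD] [C UC DE]]] := cA [set A + C | C in U_ e].
    apply: open_nbhs_nbhs; split; first exact: open_translate.
    by exists 0; [exact: U_0|rewrite addr0].
  rewrite -DE in dD; have [c ce dC] := (U_P _ _).1 UC.
  have [q [qE q0 _]] := decomposable_quadratic v dD.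
  have [t [tE _ tc]] := decomposable_quadratic v dC.
  exists (q - t).
    by rewrite of_realB -qE -tE V_addE innerDl addrK.
  have := ler_wpM2r (sqr_ge0 (norm2 v)) (ltW ce); lra.
have [r rE _] := near 1 ltr01; rewrite rE -of_real0 le_of_real leNgt; apply/negP => r0.
have v0 : 0 <= norm2 v ^+ 2 by exact: sqr_ge0.
(* If [r < 0], this [e] yields [r |v|^2 / (|v|^2 + 1) <= r], which is impossible. The added 1 keeps
   the denominator positive when [v = 0]. *)
have e0 : 0 < - r / (norm2 v ^+ 2 + 1) by rewrite divr_gt0 ?oppr_gt0 // ltr_wpDl.
have [t] := near _ e0; rewrite rE => /of_real_inj <-.
have n0 : norm2 v ^+ 2 + 1 != 0 by rewrite gt_eqF // ltr_wpDl.
have -> : - r / (norm2 v ^+ 2 + 1) * norm2 v ^+ 2 =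
    - r + r / (norm2 v ^+ 2 + 1) by field.
have : r / (norm2 v ^+ 2 + 1) < 0 by move: e0; rewrite mulNr oppr_gt0.
lra.
Qed.

Lemma Gamma_plus_reproducing :
  [set: V R s] = [set B - C | B in @Gamma_plus R s & C in @Gamma_plus R s].
Proof.
apply/seteqP; split=> // A _.
have [|B [C [AE dB dC]]] := @V_decomposition _ _ A (fine (norm11 A)).
  by rewrite fine_norm11.
exists B; first by apply/Gamma_plusP; eexists; exact: dB.
by exists C => //; apply/Gamma_plusP; eexists; exact: dC.
Qed.

End topology.

Theorem theorem5p9 (R : realType) (s : scalar_kind) :
  [/\ dense_in (@Gamma R s) (@Gamma_plus R s),
      @Gamma R s = closure (@Gamma_plus R s) &
      [set: V R s] =
        [set B - C | B in @Gamma_plus R s & C in @Gamma_plus R s]].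
Proof.
by split; [exact: Gamma_dense|exact: Gamma_closure|exact: Gamma_plus_reproducing].
Qed.
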